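(* Let $\rho=\lambda-(\sup(p_0)-\inf(p_0))$. Suppose that $\rho>0$ and that $$\sup_{i\in F^*}\sum_{j\in F^*,\,j\ne i}Q_{i,j}<+\infty\quad\text{and}\quad \sup_{i\in F^*}p_0(i)<+\infty.$$ Then for any probability measures $\mu,\nu$ on $F^*$, $$\forall t\ge0,\quad d_{\mathrm{TV}}(\mu T_t,\nu T_t)\le e^{-\rho t}d_{\mathrm{TV}}(\mu,\nu).$$ In particular, there exists a unique quasi-stationary distribution $\nu_{\mathrm{qs}}$ for $(T_t)_{t\ge0}$, and for any probability measure $\mu$ on $F^*$, $$\forall t\ge0,\quad d_{\mathrm{TV}}(\mu T_t,\nu_{\mathrm{qs}})\le e^{-\rho t}.$$
   Context: $F^*$ is a (finite or infinite) countable discrete set, and $(Q_{i,j})_{i,j\in F^*}$ is the transition rate matrix of an irreducible, positive recurrent continuous-time Markov process on $F^*$. The function $p_0:F^*\to[0,\infty)$ (death rate) is not identically zero; $\sup(p_0),\inf(p_0)$ are taken over $F^*$. $F=F^*\cup\{0\}$ with $0\notin F^*$. The parameter $\lambda$ is $$\lambda=\inf_{i,i'\in F^*,\,i\ne i'}\Big(Q_{i,i'}+Q_{i',i}+\sum_{j\ne i,i'}Q_{i,j}\wedge Q_{i',j}\Big).$$ Conditioned semigroup: let $(P_t)_{t\ge0}$ be the semigroup on $F$ of the Markov process with generator $Gf(i)=p_0(i)(f(0)-f(i))+\sum_{j\in F^*}Q_{i,j}(f(j)-f(i))$ for $i\in F^*$ and $Gf(0)=0$ (so $0$ is absorbing).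 For a probability measure $\mu$ on $F^*$, $\mu T_t$ is the law at time $t$ of this process started from $\mu$ and conditioned on non-absorption up to time $t$: for $f$ on $F^*$, with the convention $f(0)=0$, $$\mu T_t f=\frac{\sum_{y\in F^*}P_tf(y)\mu(y)}{\sum_{y\in F^*}P_t\mathbf{1}_{\{0\}^c}(y)\mu(y)}.$$ A quasi-stationary distribution is a probability measure $\nu_{\mathrm{qs}}$ on $F^*$ with $\nu_{\mathrm{qs}}T_t=\nu_{\mathrm{qs}}$ for every $t\ge0$. Total variation distance: $d_{\mathrm{TV}}(\mu,\mu')=\frac12\sup_{\|f\|_\infty\le1}(\int f\,d\mu-\int f\,d\mu')$. *)

(* Defs.v *)
From HB Require Import structures.
From mathcomp Require Import all_boot all_order all_algebra.
From mathcomp Require Import all_classical all_reals all_analysis.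
From mathcomp Require Import measurable_realfun.

Set Implicit Arguments.
Unset Strict Implicit.
Unset Printing Implicit Defensive.

Import Order.TTheory GRing.Theory Num.Theory.
Import numFieldNormedType.Exports.

Local Open Scope classical_set_scope.
Local Open Scope ring_scope.

(* The countable discrete space F^* is a type [E : countType], the absorbing
   point 0 is [None : option E], so that F = F^* U {0} is [option E].
   A measure on a countable discrete space is given by its point masses. *)

Section Sums.
Context {R : realType} {I : choiceType}.

(* Sum of an absolutely summable real family of arbitrary signs, as the sum of
   the positive parts minus the sum of the negative parts. *)
Definition dsum (u : I -> R) : R :=
  fine (\esum_(i in [set: I]) (Num.max (u i) 0)%:E)
  - fine (\esum_(i in [set: I]) (Num.max (- u i) 0)%:E).

Definition is_prob (mu : I -> R) : Prop :=
  (forall i, 0 <= mu i) /\ (\esum_(i in [set: I]) (mu i)%:E = 1)%E.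

Definition expect (mu : I -> R) (f : I -> R) : R := dsum (fun i => mu i * f i).

Definition bounded_on (f : I -> R) : Prop := exists C, forall i, `|f i| <= C.

(* Laws are compared through the functionals f |-> \int f d mu they define. *)
Definition dTV (m m' : (I -> R) -> R) : \bar R :=
  ((2^-1)%:E *
   ereal_sup [set (m f - m' f)%:E | f in
     [set f : I -> R | (forall i, `|f i| <= 1)%R]])%E.

End Sums.

Section RateMatrix.
Context {R : realType} {E : countType}.
Implicit Types Q : E -> E -> R.

Definition exit_rate Q (i : E) : \bar R :=
  \esum_(j in [set j | j != i]) (Q i j)%:E.

Definition is_rate_matrix Q : Prop :=
  (forall i j, i != j -> 0 <= Q i j) /\
  (forall i, exit_rate Q i = (- Q i i)%:E).

Definition irreducible_rates Q : Prop :=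
  forall i j, exists s : seq E,
    path (fun x y => (x != y) && (0 < Q x y)) i s /\ last i s = j.

Definition jump_matrix Q (i j : E) : R :=
  if Q i i == 0 then (i == j)%:R
  else if i == j then 0 else Q i j / - Q i i.

(* [Y] and [S] are the jump chain and the holding times of the Markov process
   with rates [Q] started from [i]: [Y] is the Markov chain with transition
   matrix [jump_matrix Q] and, given [Y], the [S n] are independent
   exponential variables with parameters [- Q (Y n) (Y n)] (a parameter 0
   means an infinite holding time). *)
Definition is_jump_process Q (i : E) d (Omega : measurableType d)
    (Pr : probability Omega R)
    (Y : nat -> Omega -> E) (S : nat -> Omega -> \bar R) : Prop :=
  [/\ (forall n x, measurable (Y n @^-1` [set x])),
      (forall n, measurable_fun [set: Omega] (S n)),
      (forall n w, (0 <= S n w)%E) &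
      forall n (y : nat -> E) (s : nat -> R), (forall k, 0 <= s k) ->
        Pr [set w | forall k, (k <= n)%N -> Y k w = y k /\ ((s k)%:E < S k w)%E]
        = ((y 0%N == i)%:R * (\prod_(k < n) jump_matrix Q (y k) (y k.+1))
           * \prod_(k < n.+1) expR (Q (y k) (y k) * s k))%:E].

(* First time of return to [i]: the least of the jump times
   S 0 + ... + S n over the n such that the jump leads to [i];
   it is +oo when there is no return. *)
Definition return_time (i : E) (Omega : Type)
    (Y : nat -> Omega -> E) (S : nat -> Omega -> \bar R) (w : Omega) : \bar R :=
  ereal_inf [set (\sum_(k < n.+1) S k w)%E | n in [set n | Y n.+1 w = i]].

Definition positive_recurrent Q : Prop :=
  forall i, Q i i = 0 \/
    exists d (Omega : measurableType d) (Pr : probability Omega R)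
           (Y : nat -> Omega -> E) (S : nat -> Omega -> \bar R),
      is_jump_process Q i Pr Y S /\
      (\int[Pr]_w return_time i Y S w < +oo)%E.

(* The infimum of the empty set is +oo: [lambda Q = +oo] when F^* is a
   singleton. *)
Definition lambda Q : \bar R :=
  ereal_inf [set x : \bar R | exists i i', i != i' /\
    x = ((Q i i')%:E + (Q i' i)%:E
         + \esum_(j in [set j | j != i /\ j != i'])
             (Num.min (Q i j) (Q i' j))%:E)%E].

End RateMatrix.

Section ConditionedSemigroup.
Context {R : realType} {E : countType}.
Implicit Types Q : E -> E -> R.

Definition gen Q (p0 : E -> R) (f : option E -> R) (x : option E) : R :=
  match x with
  | Some i => p0 i * (f None - f (Some i))
              + dsum (fun j => Q i j * (f (Some j) - f (Some i)))
  | None => 0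
  end.

(* Transition function of a Markov process on F with generator [gen Q p0]. *)
Definition is_semigroup Q (p0 : E -> R)
    (P : R -> option E -> option E -> R) : Prop :=
  [/\ (forall t x, 0 <= t -> is_prob (P t x)),
      (forall x y, P 0 x y = (x == y)%:R),
      (forall s t x z, 0 <= s -> 0 <= t ->
         P (s + t) x z = expect (P s x) (fun y => P t y z)) &
      (forall f x, bounded_on f ->
         h^-1 * (expect (P h x) f - f x) @[h --> 0^'+] --> gen Q p0 f x)].

Definition ext0 (f : E -> R) (x : option E) : R := if x is Some i then f i else 0.

(* f |-> mu T_t f *)
Definition condT (P : R -> option E -> option E -> R) (mu : E -> R) (t : R)
    (f : E -> R) : R :=
  expect mu (fun y => expect (P t (Some y)) (ext0 f))
  / expect mu (fun y => expect (P t (Some y)) (ext0 (fun=> 1))).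

Definition is_qsd (P : R -> option E -> option E -> R) (nu : E -> R) : Prop :=
  is_prob nu /\
  forall t, 0 <= t -> forall f, bounded_on f -> condT P nu t f = expect nu f.

End ConditionedSemigroup.

(* Main.v *)
Require Import Defs.
From HB Require Import structures.
From mathcomp Require Import all_boot all_order all_algebra.
From mathcomp Require Import all_classical all_reals all_analysis.
From mathcomp Require Import measurable_realfun.
From mathcomp Require Import finmap ring lra.
Set Implicit Arguments.
Unset Strict Implicit.
Unset Printing Implicit Defensive.
Import Order.TTheory GRing.Theory Num.Theory.
Import numFieldNormedType.Exports.
Local Open Scope classical_set_scope.
Local Open Scope ring_scope.

(* Bounded rates make the generator G a bounded operator, and
   |P_h f - f - h G f| = O(h^2) uniformly over |f| <= 1.  Write K_h for P_h
   restricted to F^*, f for a function with values in [0, 1], c = nu T_h f and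
   g = f - c.  Then nu K_h g = 0, so that
     mu T_h f - nu T_h f = (mu K_h g - nu K_h g) / mu K_h 1
   is at most d_TV(mu, nu) times the oscillation of K_h g, divided by
   mu K_h 1 >= 1 - sup(p0) h - o(h).  Since g has values in [-c, 1 - c], that
   oscillation is at most sup K_h 1 minus the common mass of K_h(x, .) and
   K_h(y, .), that is 1 - (lambda + inf(p0)) h + o(h).  Hence T_h contracts d_TV
   by a factor 1 - rho h + o(h), with o(h) uniform in the initial laws;
   composing T_(t/n) with itself n times gives the factor e^(-rho t).  The
   quasi-stationary distribution is the limit of the law at time n, which is
   Cauchy in total variation. *)

(** * Sums of absolutely summable families *)

(** [T_h] is nonlinear: it divides by a survival probability that depends on the initial law.
    Centring f at c = nu T_h f removes the normalisation of nu and leaves a linear difference over a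
    single denominator, that of mu. This is why sup(p0) is paid once, while inf(p0) is gained from
    the oscillation: as c lies in [0, 1], the weights 1 - c and c form a convex combination of
    survival probabilities, and c drops out of the bound. The other obstacle is uniformity. The
    semigroup is characterised by pointwise right derivatives at time 0 only, and many small-time
    errors are accumulated; bounded rates are what makes these errors uniform over states and test
    functions. A loss 5e in the rate is carried along and removed at fixed t. *)

Section AbsoluteSums.
Context {R : realType} {I : choiceType}.
Implicit Types (u v : I -> R).

(** [fine] sends +oo to 0, so a divergent positive or negative part would spoil additivity of
    [dsum]. This condition keeps both parts finite. *)
Definition asummable u := (\esum_(i in [set: I]) `|u i|%:E < +oo)%E.

Lemma esum_EFin_ge0 u (D : set I) : (forall i, 0 <= u i) ->
  (0 <= \esum_(i in D) (u i)%:E)%E.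
Proof. by move=> u0; apply: esum_ge0 => i _; rewrite lee_fin. Qed.

Lemma le_asummable u v : (forall i, `|u i| <= v i) -> asummable v -> asummable u.
Proof.
move=> uv; apply: le_lt_trans; apply: le_esum => i _.
by rewrite lee_fin (le_trans (uv i))// ler_norm.
Qed.

Lemma asummable_nneg u : (forall i, 0 <= u i) ->
  asummable u -> (\esum_(i in [set: I]) (u i)%:E)%E \is a fin_num.
Proof.
move=> u0 su; rewrite ge0_fin_numE ?esum_EFin_ge0//; apply: le_lt_trans su.
by apply: le_esum => i _; rewrite lee_fin ler_norm.
Qed.

Lemma asummableD u v : asummable u -> asummable v -> asummable (fun i => u i + v i).
Proof.
move=> su sv; apply: le_lt_trans (lte_add_pinfty su sv).
rewrite -esumD; try by move=> i _; rewrite lee_fin.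
by apply: le_esum => i _; rewrite -EFinD lee_fin ler_normD.
Qed.

Lemma asummableN u : asummable u -> asummable (fun i => - u i).
Proof. by apply: le_lt_trans; apply: le_esum => i _; rewrite normrN. Qed.

Lemma esumZ u (c : R) : 0 <= c -> (forall i, 0 <= u i) ->
  (\esum_(i in [set: I]) (c * u i)%:E = c%:E * \esum_(i in [set: I]) (u i)%:E)%E.
Proof.
move=> c0 u0; rewrite /esum -ereal_supZl//; last first.
  by apply/set0P; exists 0%E, set0; [exact: fsets_set0|rewrite fsbig_set0].
have H (A : set I) :
    (\sum_(i \in A) (c * u i)%:E = c%:E * \sum_(i \in A) (u i)%:E)%E.
  by rewrite ge0_mule_fsumr// => i; rewrite lee_fin.
congr ereal_sup; apply/seteqP; split=> [_ [A AI <-]|_ [_ [A AI <-] <-]] /=.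
- by exists (\sum_(i \in A) (u i)%:E)%E; [exists A|rewrite H].
- by exists A => //; rewrite H.
Qed.

Lemma asummableZ u c : asummable u -> asummable (fun i => c * u i).
Proof.
rewrite /asummable => su; under eq_esum do rewrite normrM.
by rewrite esumZ// lte_mul_pinfty// lee_fin.
Qed.

Lemma dsum_nneg u : (forall i, 0 <= u i) ->
  dsum u = fine (\esum_(i in [set: I]) (u i)%:E).
Proof.
move=> u0; rewrite /dsum [X in _ - fine X]esum1 ?subr0; last first.
  by move=> i _; rewrite max_r// oppr_le0.
by congr fine; apply: eq_esum => i _; rewrite max_l.
Qed.

(** The positive part p and negative part n of u - v satisfy p + v = n + u. Summing this identity
    between nonnegative families and rearranging finite sums gives the claim. *)
Lemma dsum_sub u v : (forall i, 0 <= u i) -> (forall i, 0 <= v i) ->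
  asummable u -> asummable v -> dsum (fun i => u i - v i) = dsum u - dsum v.
Proof.
move=> u0 v0 su sv; rewrite !(dsum_nneg u0, dsum_nneg v0) /dsum.
pose p i := Num.max (u i - v i) 0; pose n i := Num.max (- (u i - v i)) 0.
have p0 i : 0 <= p i by rewrite /p le_max lexx orbT.
have n0 i : 0 <= n i by rewrite /n le_max lexx orbT.
have pn i : p i + v i = n i + u i.
  by rewrite /p /n; case: (lerP 0 (u i - v i)) => h;
    [rewrite [X in _ = X + _]max_r|rewrite [X in _ = X + _]max_l]; lra.
have sp : asummable p.
  apply: le_asummable su => i; rewrite ger0_norm// /p ge_max u0 andbT.
  by rewrite lerBlDr lerDl.
have sn : asummable n.
  apply: le_asummable sv => i; rewrite ger0_norm// /n ge_max v0 andbT.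
  by rewrite opprB lerBlDr lerDl.
have : (\esum_(i in [set: I]) (p i + v i)%:E = \esum_(i in [set: I]) (n i + u i)%:E)%E.
  by apply: eq_esum => i _; rewrite pn.
under eq_esum do rewrite EFinD; under [in RHS]eq_esum do rewrite EFinD.
rewrite !esumD; try by move=> i _; rewrite lee_fin.
move=> /(congr1 fine); rewrite !fineD ?asummable_nneg//.
by rewrite -/p -/n; move=> h; lra.
Qed.

Definition pos_part u i := Num.max (u i) 0.

Lemma asummable_pos_part u : asummable u -> asummable (pos_part u).
Proof.
move=> /le_lt_trans; apply; apply: le_esum => i _; rewrite lee_fin ger0_norm.
  by rewrite ge_max normr_ge0 ler_norm.
by rewrite le_max lexx orbT.
Qed.

Lemma pos_part_ge0 u i : 0 <= pos_part u i. Proof. by rewrite le_max lexx orbT. Qed.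

Lemma dsum_decomp u : dsum u = dsum (pos_part u) - dsum (pos_part (fun i => - u i)).
Proof. by rewrite !(dsum_nneg (pos_part_ge0 _)). Qed.

Lemma pos_part_sub u i : u i = pos_part u i - pos_part (fun i => - u i) i.
Proof.
by rewrite /pos_part; case: (lerP 0 (u i)) => h; [rewrite max_r ?subr0|rewrite max_l]; lra.
Qed.

Lemma eq_dsum u v : u =1 v -> dsum u = dsum v.
Proof. by move=> /funext ->. Qed.

Lemma dsumN u : dsum (fun i => - u i) = - dsum u.
Proof.
rewrite (dsum_decomp (fun i => - u i)) (dsum_decomp u) [RHS]opprB; congr (_ - _).
by apply: eq_dsum => i; rewrite /pos_part opprK.
Qed.

Lemma dsumD_nneg u v : (forall i, 0 <= u i) -> (forall i, 0 <= v i) ->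
  asummable u -> asummable v -> dsum (fun i => u i + v i) = dsum u + dsum v.
Proof.
move=> u0 v0 su sv; rewrite !dsum_nneg//; last by move=> i; rewrite addr_ge0.
by under eq_esum do rewrite EFinD; rewrite esumD ?fineD ?asummable_nneg// => i _; rewrite lee_fin.
Qed.

Lemma dsumD u v : asummable u -> asummable v ->
  dsum (fun i => u i + v i) = dsum u + dsum v.
Proof.
move=> su sv.
pose u' := fun i => - u i; pose v' := fun i => - v i.
rewrite (_ : dsum _ =
  dsum (fun i => (pos_part u i + pos_part v i) - (pos_part u' i + pos_part v' i))).
  have su1 := asummable_pos_part su; have sv1 := asummable_pos_part sv.
  have su2 := asummable_pos_part (asummableN su); have sv2 := asummable_pos_part (asummableN sv).
  have p0 := @pos_part_ge0.
  rewrite dsum_sub; first last.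
  - exact: asummableD su2 sv2.
  - exact: asummableD su1 sv1.
  - by move=> i; rewrite addr_ge0.
  - by move=> i; rewrite addr_ge0.
  rewrite (dsumD_nneg (p0 u) (p0 v))// (dsumD_nneg (p0 u') (p0 v'))//.
  rewrite (dsum_decomp u) (dsum_decomp v); ring.
by apply: eq_dsum => i; rewrite {1}(pos_part_sub u) {1}(pos_part_sub v) opprD addrACA.
Qed.

Lemma dsumB u v : asummable u -> asummable v ->
  dsum (fun i => u i - v i) = dsum u - dsum v.
Proof. by move=> su sv; rewrite dsumD ?dsumN//; exact: asummableN. Qed.

(** For c > 0 an infinite part stays infinite after scaling, and [fine] sends both to 0, so
    divergent families are covered too. A negative c exchanges the two parts. *)
Lemma dsumZ u c : dsum (fun i => c * u i) = c * dsum u.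
Proof.
wlog c0 : c / 0 <= c.
  move=> h; case: (lerP 0 c) => [/h//|c0].
  have {}h := h (- c); apply: oppr_inj; rewrite -dsumN -mulNr -h ?oppr_ge0 1?ltW//.
  by apply: eq_dsum => i; rewrite mulNr.
rewrite dsum_decomp [in RHS]dsum_decomp mulrBr.
have H w : dsum (pos_part (fun i => c * w i)) = c * dsum (pos_part w).
  rewrite !(dsum_nneg (pos_part_ge0 _)).
  rewrite (_ : (\esum_(i in _) _)%E = (c%:E * \esum_(i in [set: I]) (pos_part w i)%:E)%E).
    have [->|cn0] := eqVneq c 0; first by rewrite mul0e mul0r.
    have c_gt0 : (0 < c%:E)%E by rewrite lte_fin lt_neqAle eq_sym cn0.
    case: (\esum_(_ in _) _)%E => [r| |]//.
      by rewrite gt0_muley//= mulr0.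
    by rewrite gt0_muleNy//= mulr0.
  rewrite -esumZ//; last exact: pos_part_ge0.
  by apply: eq_esum => i _; rewrite /pos_part maxr_pMr// mulr0.
rewrite H; congr (_ - _); rewrite -H; apply: eq_dsum => i.
by rewrite /pos_part mulrN.
Qed.

Lemma dsum_ge0 u : (forall i, 0 <= u i) -> 0 <= dsum u.
Proof. by move=> u0; rewrite dsum_nneg// fine_ge0// esum_EFin_ge0. Qed.

Lemma le_dsum u v : asummable u -> asummable v -> (forall i, u i <= v i) ->
  dsum u <= dsum v.
Proof.
move=> su sv uv; rewrite -subr_ge0 -dsumB//; apply: dsum_ge0 => i.
by rewrite subr_ge0.
Qed.

Lemma ler_norm_dsum u : asummable u -> `|dsum u| <= dsum (fun i => `|u i|).
Proof.
move=> su; have sa : asummable (fun i => `|u i|).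
  by apply: le_lt_trans su; apply: le_esum => i _; rewrite normr_id.
rewrite ler_norml -dsumN !le_dsum//.
- by move=> i; rewrite ler_norm.
- exact: asummableN.
- by move=> i; rewrite lerNl -normrN ler_norm.
Qed.

Lemma esum_delta (i : I) (a : R) : 0 <= a ->
  (\esum_(j in [set: I]) (if j == i then a else 0)%:E = a%:E)%E.
Proof.
move=> a0; rewrite -[RHS](@esum_set1 R I i (fun=> a%:E)) ?lee_fin// [RHS]esum_mkcond.
apply: eq_esum => j _; by rewrite in_set1; case: eqP.
Qed.

Lemma dsum_delta (i : I) (a : R) : dsum (fun j => if j == i then a else 0) = a.
Proof.
wlog a0 : a / 0 <= a.
  move=> h; case: (lerP 0 a) => [/h//|a0].
  apply: oppr_inj; rewrite -dsumN -[RHS]h ?oppr_ge0 1?ltW//.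
  by apply: eq_dsum => j; case: eqP; rewrite ?oppr0.
by rewrite dsum_nneg ?esum_delta// => j; case: eqP.
Qed.

End AbsoluteSums.

(** * Bounded functions and expectations under subprobabilities *)

Section Bounded.
Context {R : realType} {I : choiceType}.
Implicit Types (f g : I -> R).

Lemma bounded_onP f : bounded_on f -> exists2 C, 0 <= C & forall i, `|f i| <= C.
Proof.
move=> [C fC]; exists (Num.max C 0); first by rewrite le_max lexx orbT.
by move=> i; rewrite le_max fC.
Qed.

Lemma bounded_on_cst (c : R) : bounded_on (fun _ : I => c).
Proof. by exists `|c|. Qed.

Lemma bounded_onD f g : bounded_on f -> bounded_on g -> bounded_on (fun i => f i + g i).
Proof.
move=> [C fC] [D gD]; exists (C + D) => i.
by rewrite (le_trans (ler_normD _ _))// lerD.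
Qed.

Lemma bounded_onN f : bounded_on f -> bounded_on (fun i => - f i).
Proof. by move=> [C fC]; exists C => i; rewrite normrN. Qed.

Lemma bounded_onB f g : bounded_on f -> bounded_on g -> bounded_on (fun i => f i - g i).
Proof. by move=> bf /bounded_onN; exact: bounded_onD. Qed.

Lemma bounded_onM f g : bounded_on f -> bounded_on g -> bounded_on (fun i => f i * g i).
Proof.
move=> /bounded_onP[C C0 fC] /bounded_onP[D D0 gD]; exists (C * D) => i.
by rewrite normrM ler_pM.
Qed.

Lemma bounded_onZ c f : bounded_on f -> bounded_on (fun i => c * f i).
Proof. exact/bounded_onM/bounded_on_cst. Qed.

Lemma bounded_on01 f : (forall i, 0 <= f i <= 1) -> bounded_on f.
Proof. by move=> f01; exists 1 => i; have /andP[f0 f1] := f01 i; rewrite ger0_norm. Qed.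

Lemma bounded_on_bool (p : pred I) : bounded_on (fun i : I => (p i)%:R : R).
Proof. by apply: bounded_on01 => i; rewrite ler0n lern1 leq_b1. Qed.

End Bounded.

Section Expectation.
Context {R : realType} {I : choiceType}.
Implicit Types (mu : I -> R) (f g : I -> R).

(** Restricting [P t x] to F^* loses the absorbed mass, so integration is developed for total mass
    at most 1. *)
Definition is_subprob mu :=
  (forall i, 0 <= mu i) /\ (\esum_(i in [set: I]) (mu i)%:E <= 1)%E.

Lemma is_prob_subprob mu : is_prob mu -> is_subprob mu.
Proof. by move=> [mu0 mu1]; split=> //; rewrite mu1. Qed.

Lemma subprob_asummable mu : is_subprob mu -> asummable mu.
Proof.
move=> [mu0 mu1]; apply: (@le_lt_trans _ _ 1%E); rewrite ?ltry//.
by apply: le_trans mu1; apply: le_esum => i _; rewrite ger0_norm.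
Qed.

Lemma asummable_expect mu f : is_subprob mu -> bounded_on f ->
  asummable (fun i => mu i * f i).
Proof.
move=> pmu [C fC]; have mu0 := pmu.1.
apply: (@le_asummable _ _ _ (fun i => C * mu i)); last exact/asummableZ/subprob_asummable.
by move=> i; rewrite normrM ger0_norm// mulrC ler_wpM2r.
Qed.

Lemma eq_expect mu f g : f =1 g -> expect mu f = expect mu g.
Proof. by move=> /funext ->. Qed.

Lemma expectD mu f g : is_subprob mu -> bounded_on f -> bounded_on g ->
  expect mu (fun i => f i + g i) = expect mu f + expect mu g.
Proof.
move=> pmu bf bg; rewrite /expect -dsumD; try exact: asummable_expect.
by apply: eq_dsum => i; rewrite mulrDr.
Qed.

Lemma expectZ mu f c : expect mu (fun i => c * f i) = c * expect mu f.
Proof. by rewrite /expect -dsumZ; apply: eq_dsum => i; rewrite mulrCA. Qed.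

Lemma expectB mu f g : is_subprob mu -> bounded_on f -> bounded_on g ->
  expect mu (fun i => f i - g i) = expect mu f - expect mu g.
Proof.
move=> pmu bf bg; rewrite /expect -dsumB; try exact: asummable_expect.
by apply: eq_dsum => i; rewrite mulrBr.
Qed.

Lemma le_expect mu f g : is_subprob mu -> bounded_on f -> bounded_on g ->
  (forall i, f i <= g i) -> expect mu f <= expect mu g.
Proof.
move=> pmu bf bg fg; apply: le_dsum; try exact: asummable_expect.
by move=> i; apply: ler_wpM2l; [exact: pmu.1|].
Qed.

Lemma expect_ge0 mu f : is_subprob mu -> (forall i, 0 <= f i) -> 0 <= expect mu f.
Proof. by move=> pmu f0; apply: dsum_ge0 => i; rewrite mulr_ge0//; exact: pmu.1. Qed.

Lemma EFin_expect mu f : is_subprob mu -> bounded_on f -> (forall i, 0 <= f i) ->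
  (expect mu f)%:E = (\esum_(i in [set: I]) (mu i * f i)%:E)%E.
Proof.
move=> pmu bf f0; have mf0 i : 0 <= mu i * f i by rewrite mulr_ge0//; exact: pmu.1.
by rewrite /expect dsum_nneg ?fineK ?asummable_nneg//; exact: asummable_expect.
Qed.

Lemma expect_cst_le mu c : is_subprob mu -> 0 <= c -> expect mu (fun=> c) <= c.
Proof.
move=> pmu c0; rewrite -lee_fin EFin_expect//; last exact: bounded_on_cst.
under eq_esum do rewrite mulrC; rewrite esumZ//; last exact: pmu.1.
by rewrite -[leRHS]mule1 lee_wpmul2l//; exact: pmu.2.
Qed.

Lemma expect_cst mu c : is_prob mu -> expect mu (fun=> c) = c.
Proof.
move=> [mu0 mu1]; rewrite (@eq_expect mu _ (fun=> c * 1)) ?expectZ; last by move=> i; rewrite mulr1.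
have -> : expect mu (fun=> 1) = 1; last by rewrite mulr1.
rewrite /expect dsum_nneg => [|i]; last by rewrite mulr1.
by under eq_esum do rewrite mulr1; rewrite mu1.
Qed.

Lemma ler_norm_expect mu f C : is_subprob mu -> 0 <= C ->
  (forall i, `|f i| <= C) -> `|expect mu f| <= C.
Proof.
move=> pmu C0 fC; have bf : bounded_on f by exists C.
apply: (le_trans _ (expect_cst_le pmu C0)); rewrite ler_norml.
have bc : bounded_on (fun _ : I => C) by exact: bounded_on_cst.
rewrite lerNl -mulN1r -expectZ !le_expect//.
- by move=> i; rewrite (le_trans _ (fC i))// ler_norm.
- by exact: bounded_onZ.
- by move=> i; rewrite mulN1r (le_trans _ (fC i))// -normrN ler_norm.
Qed.

Lemma expect_ge0_le1 mu f : is_subprob mu -> (forall i, 0 <= f i <= 1) ->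
  0 <= expect mu f <= 1.
Proof.
move=> pmu f01; have f0 i : 0 <= f i by case/andP: (f01 i).
rewrite expect_ge0//= (le_trans (ler_norm _))// ler_norm_expect// => i.
by rewrite ger0_norm//; case/andP: (f01 i).
Qed.

Lemma expect_point mu i : expect mu (fun j => (j == i)%:R) = mu i.
Proof.
rewrite /expect -[RHS](dsum_delta i); apply: eq_dsum => j.
by case: eqP => [->|_]; rewrite ?mulr1 ?mulr0.
Qed.

End Expectation.

(** * Interchange of sums and mixtures of kernels *)

Section Fubini.
Context {R : realType} {I J : choiceType}.
Implicit Types (mu : I -> R) (k : I -> J -> R).

Lemma exchange_esum (a : I -> J -> \bar R) : (forall i j, 0 <= a i j)%E ->
  (\esum_(i in [set: I]) \esum_(j in [set: J]) a i j =
   \esum_(j in [set: J]) \esum_(i in [set: I]) a i j)%E.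
Proof.
move=> a0; rewrite !esum_esum//.
rewrite (@reindex_esum R (J * I)%type (I * J)%type ([set: J] `*`` fun=> [set: I])
  ([set: I] `*`` fun=> [set: J]) (fun x => (x.2, x.1)))//.
by split=> //= [[? ?] [? ?] _ _ [-> ->]//|[i j] _]; exists (j, i).
Qed.

(** The law of j when i is drawn from [mu] and then j from [k i]. Both the Chapman-Kolmogorov
    equation and the unnormalised conditioned law have this form. *)
Definition mixture mu k (j : J) : R := expect mu (k^~ j).

Lemma subprob_le1 {K : choiceType} (m : K -> R) i : is_subprob m -> 0 <= m i <= 1.
Proof.
move=> pm; rewrite -(expect_point m i); apply: expect_ge0_le1 => // j.
by rewrite ler0n lern1 leq_b1.
Qed.

Section Mixture.
Variables (mu : I -> R) (k : I -> J -> R).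
Hypotheses (pmu : is_subprob mu) (pk : forall i, is_subprob (k i)).

Let k0 i j : 0 <= k i j. Proof. by case/andP: (subprob_le1 j (pk i)). Qed.

Lemma mixture_ge0 j : 0 <= mixture mu k j.
Proof. exact: expect_ge0. Qed.

Lemma esum_mixture (f : J -> R) : bounded_on f -> (forall j, 0 <= f j) ->
  (\esum_(j in [set: J]) (mixture mu k j * f j)%:E = (expect mu (fun i => expect (k i) f))%:E)%E.
Proof.
move=> bf f0; have [C C0 fC] := bounded_onP bf.
have H j : ((mixture mu k j * f j)%:E = \esum_(i in [set: I]) (mu i * (k i j * f j))%:E)%E.
  rewrite mulrC EFinM EFin_expect//; last first.
    by apply: bounded_on01 => i; exact: subprob_le1.
  rewrite -esumZ//; last by move=> i; rewrite mulr_ge0//; exact: pmu.1.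
  by apply: eq_esum => i _; congr EFin; ring.
under eq_esum do rewrite H.
rewrite -exchange_esum; last by move=> i j; rewrite lee_fin !mulr_ge0//; exact: pmu.1.
rewrite EFin_expect//; last first.
- by move=> i; exact: expect_ge0.
- by exists C => i; exact: ler_norm_expect.
apply: eq_esum => i _; rewrite EFinM EFin_expect// -esumZ//; first exact: pmu.1.
by move=> j; rewrite mulr_ge0.
Qed.

Lemma is_subprob_mixture : is_subprob (mixture mu k).
Proof.
split; first exact: mixture_ge0.
under eq_esum do rewrite -[mixture _ _ _]mulr1.
rewrite esum_mixture//; last exact: bounded_on_cst.
rewrite lee_fin; have h1 i : 0 <= expect (k i) (fun=> 1) <= 1.
  by apply: expect_ge0_le1 => // _; rewrite ler01 lexx.
by case/andP: (expect_ge0_le1 pmu h1).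
Qed.

Lemma expect_mixture (f : J -> R) : bounded_on f ->
  expect (mixture mu k) f = expect mu (fun i => expect (k i) f).
Proof.
move=> bf; have [C C0 fC] := bounded_onP bf.
have H g : bounded_on g -> (forall j, 0 <= g j) ->
    expect (mixture mu k) g = expect mu (fun i => expect (k i) g).
  move=> bg g0; apply: EFin_inj; rewrite -esum_mixture// EFin_expect//.
  exact: is_subprob_mixture.
have bC : bounded_on (fun _ : J => C) by exact: bounded_on_cst.
have bE g : bounded_on g -> bounded_on (fun i => expect (k i) g).
  by move=> /bounded_onP[D D0 gD]; exists D => i; exact: ler_norm_expect.
(* Adding the bound C makes f nonnegative, which brings it within reach of Tonelli. *)
have fE : f =1 (fun j => f j + C - C) by move=> j; rewrite addrK.
have bfC : bounded_on (fun j => f j + C) by exact: bounded_onD.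
rewrite (eq_expect _ fE) expectB//; last exact: is_subprob_mixture.
rewrite !H//; last by move=> j; have := fC j; rewrite ler_norml; lra.
rewrite -expectB//; try exact: bE.
by apply: eq_expect => i; rewrite -expectB//; apply: eq_expect => j; rewrite addrK.
Qed.

End Mixture.
End Fubini.

(** * Total variation *)

Section TotalVariation.
Context {R : realType} {E : countType}.
Implicit Types (mu nu f phi : E -> R) (D e : R).

(** Between probability measures this says that D bounds the total variation distance. A real upper
    bound composes along time steps without handling extended suprema, and values in [0, 1] put the
    centring constant c in [0, 1]. *)
Definition tv_le mu nu D := forall f : E -> R, (forall i, 0 <= f i <= 1) ->
  expect mu f - expect nu f <= D.

Lemma tv_le_ge0 mu nu D : tv_le mu nu D -> 0 <= D.
Proof.
move=> /(_ (fun=> 0)).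
have H (m : E -> R) : expect m (fun=> 0) = 0.
  rewrite -[RHS](mul0r (expect m (fun=> 0))) -expectZ.
  by apply: eq_expect => i; rewrite mul0r.
by rewrite !H subrr; apply=> i; rewrite lexx ler01.
Qed.

(** The function (phi - inf phi) / k takes values in [0, 1], and constants cancel because both
    masses are 1. Through this lemma an oscillation bound for the killed semigroup becomes a
    contraction factor. *)
Lemma expect_osc (x0 : E) mu nu D phi (k : R) :
  is_prob mu -> is_prob nu -> tv_le mu nu D ->
  0 < k -> bounded_on phi -> (forall x y, phi x - phi y <= k) ->
  expect mu phi - expect nu phi <= k * D.
Proof.
move=> pmu pnu Hd k0 bphi osc; pose a := inf (range phi).
have lb : has_lbound (range phi).
  by exists (phi x0 - k) => _ [y _ <-]; have := osc x0 y; lra.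
have ale y : a <= phi y by apply: ge_inf => //; exists y.
have alk y : phi y - k <= a.
  apply: lb_le_inf; first by exists (phi x0), x0.
  by move=> _ [z _ <-]; have := osc y z; lra.
have bc : bounded_on (fun _ : E => a) by exact: bounded_on_cst.
have smu := is_prob_subprob pmu; have snu := is_prob_subprob pnu.
have Ea m : is_prob m -> expect m (fun y => k^-1 * (phi y - a)) = k^-1 * (expect m phi - a).
  move=> pm'; rewrite expectZ expectB ?expect_cst//; exact: is_prob_subprob.
have := Hd (fun y => k^-1 * (phi y - a)); rewrite !Ea// -mulrBr.
rewrite opprB addrA subrK ler_pdivrMl//; apply=> y.
rewrite mulr_ge0 ?invr_ge0 ?subr_ge0 ?(ltW k0)//= ler_pdivrMl// mulr1.
by have := alk y; lra.
Qed.

(** Testing against 1 - f reverses the sign, as both masses are 1. *)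
Lemma tv_le_sym mu nu D : is_prob mu -> is_prob nu -> tv_le mu nu D -> tv_le nu mu D.
Proof.
move=> pmu pnu Hd f f01; have bf := bounded_on01 f01.
have b1 : bounded_on (fun _ : E => 1 : R) by exact: bounded_on_cst.
have := Hd (fun i => 1 - f i).
rewrite !expectB//; try exact: is_prob_subprob.
rewrite !expect_cst// => H.
suff : 1 - expect mu f - (1 - expect nu f) <= D by lra.
by apply: H => i; have /andP[? ?] := f01 i; apply/andP; split; lra.
Qed.

Lemma tv_le1 mu nu : is_prob mu -> is_prob nu -> tv_le mu nu 1.
Proof.
move=> /is_prob_subprob pmu /is_prob_subprob pnu f f01.
have /andP[_ h1] := expect_ge0_le1 pmu f01.
have /andP[h0 _] := expect_ge0_le1 pnu f01.
lra.
Qed.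

Lemma tv_le_trans mu nu (m : E -> R) D1 D2 : tv_le mu nu D1 -> tv_le nu m D2 -> tv_le mu m (D1 + D2).
Proof. by move=> H1 H2 f f01; have := H1 f f01; have := H2 f f01; lra. Qed.

Lemma tv_le_point mu nu D i : tv_le mu nu D -> mu i - nu i <= D.
Proof.
move=> Hd; rewrite -(expect_point mu) -(expect_point nu); apply: Hd => j.
by rewrite ler0n lern1 leq_b1.
Qed.

Lemma tv_le0_eq mu nu : is_prob mu -> is_prob nu ->
  (forall e, 0 < e -> tv_le mu nu e) -> mu = nu.
Proof.
move=> pmu pnu H; apply/funext => i; apply/eqP; rewrite eq_le.
apply/andP; split; apply/ler_addgt0Pr => e e0.
- by have := tv_le_point i (H e e0); lra.
- by have := tv_le_point i (tv_le_sym pmu pnu (H e e0)); lra.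
Qed.

Lemma sum_le_expect (m : E -> R) f (s : seq E) : is_subprob m -> bounded_on f ->
  (forall i, 0 <= f i) -> uniq s -> \sum_(i <- s) m i * f i <= expect m f.
Proof.
move=> pm bf f0 us; rewrite -lee_fin EFin_expect// -sumEFin.
apply: esum_ge; exists [set` s]; first by split=> //; exact: finite_seq.
by rewrite fsbig_seq.
Qed.

Lemma esum_le_seq (u : E -> R) D : (forall s, uniq s -> \sum_(i <- s) u i <= D) ->
  (\esum_(i in [set: E]) (u i)%:E <= D%:E)%E.
Proof.
move=> H; apply: ge_ereal_sup => _ [A [fA _] <-].
by rewrite fsbig_finite//= sumEFin lee_fin; apply: H; exact: fset_uniq.
Qed.

Lemma expect_mem_seq (m : E -> R) (s : seq E) : is_subprob m -> uniq s ->
  expect m (fun i => (i \in s)%:R) = \sum_(i <- s) m i.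
Proof.
move=> pm; elim: s => [_|x s IH /= /andP[xs us]].
  rewrite big_nil -[RHS](mul0r (expect m (fun=> 0))) -expectZ.
  by apply: eq_expect => i; rewrite mul0r.
rewrite big_cons -IH// -[X in X + _](expect_point m x) -expectD//.
- apply: eq_expect => i; rewrite inE.
  by have [->|] := eqVneq i x; rewrite ?(negbTE xs) ?addr0 ?add0r.
- exact: bounded_on_bool.
- exact: bounded_on_bool.
Qed.

Lemma esum_seq_gt (u : E -> R) (a : R) : (forall i, 0 <= u i) ->
  (a%:E < \esum_(i in [set: E]) (u i)%:E)%E ->
  exists2 s, uniq s & a < \sum_(i <- s) u i.
Proof.
move=> u0 /ereal_sup_gt[_ [A [fA _] <-]].
rewrite fsbig_finite//= sumEFin lte_fin => H.
by exists (fset_set A) => //; exact: fset_uniq.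
Qed.

(* [nu i] is squeezed between all the [m n i - c n] and all the [m n i + c n];
   total mass 1 follows because the [m n] are uniformly tight. *)
Lemma tv_complete (m : nat -> E -> R) (c : nat -> R) : (forall n, is_prob (m n)) ->
  (forall n k, tv_le (m n) (m k) (c n + c k)) ->
  (forall e, 0 < e -> exists n, c n <= e) ->
  exists2 nu, is_prob nu & forall n, tv_le nu (m n) (c n).
Proof.
move=> pm Hd c_small; have sm n := is_prob_subprob (pm n).
pose S i := range (fun n => m n i - c n); pose nu i := sup (S i).
have Sub i k : ubound (S i) (m k i + c k).
  by move=> _ [n _ <-]; have := tv_le_point i (Hd n k); lra.
have nu_lo i n : m n i - c n <= nu i.
  by apply: ub_le_sup; [exists (m n i + c n); exact: Sub|exists n].
have nu_hi i n : nu i <= m n i + c n.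
  by apply: ge_sup; [exists (m n i - c n), n|exact: Sub].
have nu0 i : 0 <= nu i.
  apply/ler_addgt0Pr => e /c_small[n cn].
  by have := nu_lo i n; have := (pm n).1 i; lra.
(* Pointwise errors [c k] add up over a finite list of states, so k must be chosen after the
   list. *)
have small (N : nat) e : 0 < e -> exists k, N%:R * c k <= e.
  move=> e0; have [k ck] := c_small (e / N.+1%:R) (divr_gt0 e0 (ltr0Sn _ _)).
  exists k; apply: (@le_trans _ _ (N%:R * (e / N.+1%:R))); first by rewrite ler_wpM2l.
  rewrite mulrCA ler_piMr ?(ltW e0)// ler_pdivrMr// mul1r ler_nat//.
have fin_le (s : seq E) f n : uniq s -> (forall i, 0 <= f i <= 1) ->
    \sum_(i <- s) nu i * f i <= expect (m n) f + c n.
  move=> us f01; apply/ler_addgt0Pr => e e0.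
  (* [size s] copies of [c k] pay for the pointwise errors, one more for the distance between [m k]
     and [m n]. *)
  have [k Hk] := small (size s).+1 e e0.
  have fk : \sum_(i <- s) m k i * f i <= expect (m k) f.
    by apply: sum_le_expect => //; [exact: bounded_on01|move=> i; case/andP: (f01 i)].
  have ck0 : 0 <= c k by have := tv_le_ge0 (Hd k k); lra.
  have : \sum_(i <- s) nu i * f i <= \sum_(i <- s) (m k i * f i + c k).
    apply: ler_sum => i _; have /andP[f0 f1] := f01 i.
    have : nu i * f i <= (m k i + c k) * f i by rewrite ler_wpM2r.
    have : c k * f i <= c k by rewrite ler_piMr.
    lra.
  rewrite big_split/= big_const_seq count_predT iter_addr addr0 -mulr_natl.
  have := Hd k n f f01; move: Hk; rewrite -natr1 mulrDl mul1r; lra.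
have nu_sub : is_subprob nu.
  split=> //; apply: esum_le_seq => s us; apply/ler_addgt0Pr => e /c_small[n cn].
  have := fin_le s (fun=> 1) n us; rewrite (expect_cst _ (pm n)).
  under eq_bigr do rewrite mulr1.
  move=> H; have {}H := H (fun=> introT andP (conj ler01 (lexx 1))).
  by apply: le_trans H _; rewrite lerD2l.
have nu_tv n : tv_le nu (m n) (c n).
  move=> f f01; rewrite lerBlDr addrC -lee_fin EFin_expect//; last 2 first.
  - exact: bounded_on01.
  - by move=> i; case/andP: (f01 i).
  by apply: esum_le_seq => s us; exact: fin_le.
exists nu => //; split=> //; apply/eqP; rewrite eq_le nu_sub.2/=.
suff H e : 0 < e -> (1 <= \esum_(i in [set: E]) (nu i)%:E + e%:E)%E.
  by apply/lee_addgt0Pr.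
(* The three thirds pay for the mass of [m n] outside s, for [c n], and for the [size s + 1] copies
   of [c k]. *)
move=> e0; have e3 : 0 < e / 3 by rewrite divr_gt0.
have [n cn] := c_small _ e3.
have [s us Hs] : exists2 s, uniq s & 1 - e / 3 < \sum_(i <- s) m n i.
  by apply: esum_seq_gt; [exact: (pm n).1|rewrite (pm n).2 lte_fin; lra].
have [k Hk] := small (size s).+1 _ e3.
have ck0 : 0 <= c k by have := tv_le_ge0 (Hd k k); lra.
have : \sum_(i <- s) m k i <= \sum_(i <- s) (nu i + c k).
  by apply: ler_sum => i _; have := nu_lo i k; lra.
rewrite big_split/= big_const_seq count_predT iter_addr addr0 -mulr_natl => H1.
have := Hd n k (fun i => (i \in s)%:R); rewrite !expect_mem_seq// => H2.
have {}H2 : \sum_(i <- s) m n i - \sum_(i <- s) m k i <= c n + c k.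
  by apply: H2 => i; rewrite ler0n lern1 leq_b1.
have b1 : bounded_on (fun _ : E => 1 : R) by exact: bounded_on_cst.
have H3 := sum_le_expect nu_sub b1 (fun=> ler01) us.
have -> : (\esum_(i in [set: E]) (nu i)%:E)%E = (expect nu (fun=> 1))%:E.
  by rewrite EFin_expect//; apply: eq_esum => i _; rewrite mulr1.
rewrite -EFinD lee_fin; move: Hk H3; rewrite -natr1 mulrDl mul1r.
under eq_bigr do rewrite mulr1.
lra.
Qed.

Lemma eq_dTV (u v u' v' : (E -> R) -> R) :
  (forall f, bounded_on f -> u f = u' f) -> (forall f, bounded_on f -> v f = v' f) ->
  dTV u v = dTV u' v'.
Proof.
move=> uu' vv'; rewrite /dTV; congr (_ * ereal_sup _)%E.
by apply/seteqP; split=> _ [f f1 <-]; exists f => //;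
  rewrite (uu' f, uu') ?(vv' f)//; exists 1.
Qed.

(** The substitution of (f + 1) / 2 for f carries [-1, 1] to [0, 1]; the factor 1/2 in [dTV] absorbs
    the change of scale. *)
Lemma dTV_le mu nu D : is_prob mu -> is_prob nu -> tv_le mu nu D ->
  (dTV (expect mu) (expect nu) <= D%:E)%E.
Proof.
move=> pmu pnu Hd; rewrite /dTV.
rewrite (_ : D%:E = (2^-1)%:E * (2 * D)%:E)%E; last first.
  by rewrite -EFinM mulKf.
apply: lee_wpmul2l; first by rewrite lee_fin.
apply: ge_ereal_sup => _ [f f1 <-]; rewrite lee_fin.
have := Hd (fun i => 2^-1 * (f i + 1)).
have bf : bounded_on f by exists 1.
have b1 : bounded_on (fun _ : E => 1 : R) by exact: bounded_on_cst.
rewrite !expectZ !expectD//; try exact: is_prob_subprob.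
rewrite !expect_cst// => H.
suff : 2^-1 * (expect mu f + 1) - 2^-1 * (expect nu f + 1) <= D by lra.
by apply: H => i; have := f1 i; rewrite ler_norml => /andP[? ?]; apply/andP; split; lra.
Qed.

Lemma dTV_ge0 mu nu : is_prob mu -> is_prob nu -> (0 <= dTV (expect mu) (expect nu))%E.
Proof.
move=> pmu pnu; rewrite mule_ge0 ?lee_fin//; apply: ereal_sup_ubound.
exists (fun=> 0); first by move=> i; rewrite normr0.
by rewrite !expect_cst// subrr.
Qed.

Lemma tv_le_dTV mu nu : is_prob mu -> is_prob nu ->
  exists2 D, dTV (expect mu) (expect nu) = D%:E & tv_le mu nu D.
Proof.
move=> pmu pnu; have d0 := dTV_ge0 pmu pnu; have d1 := dTV_le pmu pnu (tv_le1 pmu pnu).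
have dfin : dTV (expect mu) (expect nu) \is a fin_num.
  by rewrite ge0_fin_numE// (le_lt_trans d1)// ltry.
exists (fine (dTV (expect mu) (expect nu))); first by rewrite fineK.
move=> f f01; rewrite -lee_fin fineK// /dTV.
have bf := bounded_on01 f01.
have b1 : bounded_on (fun _ : E => 1 : R) by exact: bounded_on_cst.
have bf2 : bounded_on (fun i => 2 * f i) by exact: bounded_onZ.
rewrite (_ : (expect mu f - expect nu f)%:E =
  ((2^-1)%:E * (expect mu (fun i => 2 * f i - 1) - expect nu (fun i => 2 * f i - 1))%:E)%E).
  apply: lee_wpmul2l; first by rewrite lee_fin.
  apply: ereal_sup_ubound; exists (fun i => 2 * f i - 1) => // i.
  by have /andP[? ?] := f01 i; rewrite ler_norml; apply/andP; split; lra.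
rewrite -EFinM !expectB//; try exact: is_prob_subprob.
by rewrite !expectZ !expect_cst//; congr EFin; field.
Qed.

End TotalVariation.

(** * Expansion of the semigroup at time 0 *)

(** A mean value inequality from one-sided slopes. The times where the bound with slope M + e holds
    have a supremum m; the Lipschitz bound puts m among them, and the right slope at m would carry
    the bound beyond m if m < h. *)
Lemma le_of_right_slope {R : realType} (F : R -> R) (L M h : R) : 0 <= h ->
  (forall s t, 0 <= s -> 0 <= t -> `|F (s + t) - F s| <= L * t) ->
  (forall t, 0 <= t < h -> forall e, 0 < e -> exists2 d, 0 < d &
     forall s, 0 < s < d -> F (t + s) - F t <= (M + e) * s) ->
  F h - F 0 <= M * h.
Proof.
move=> h0 lipF slopeF.
have [->|hn0] := eqVneq h 0; first by rewrite subrr mulr0.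
have hpos : 0 < h by rewrite lt_neqAle eq_sym hn0.
suff He : forall e, 0 < e -> F h - F 0 <= (M + e) * h.
  apply/ler_addgt0Pr => e e0; rewrite (le_trans (He (e / h) _)) ?divr_gt0//.
  by rewrite mulrDl divfK ?gt_eqF.
move=> e e0; pose A := [set t | 0 <= t <= h /\ F t - F 0 <= (M + e) * t].
have A0 : A 0 by rewrite /A/= lexx h0 subrr mulr0.
have Aub : has_sup A.
  by split; [exists 0|exists h => t [/andP[]]].
pose m := sup A.
have m0 : 0 <= m by apply: ub_le_sup => //; case: Aub.
have mh : m <= h by apply: ge_sup; [exists 0|move=> t [/andP[]]].
have mA : F m - F 0 <= (M + e) * m.
  (* Passing from a time t of [A] to m costs at most (|M + e| + |L|) (m - t), so t is taken close
     enough to m to keep this below k. *)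
  apply/ler_addgt0Pr => k k0.
  have N0 : 0 < `|M + e| + `|L| + 1 by rewrite ltr_wpDl ?addr_ge0.
  have [t [/andP[t0 th] Ht] mt] := sup_adherent (divr_gt0 k0 N0) Aub.
  have tm : t <= m by apply: ub_le_sup; [case: Aub|split=> //; rewrite t0].
  have := lipF t (m - t) t0; rewrite subr_ge0 => /(_ tm); rewrite [t + _]addrC subrK.
  move=> /(le_trans (ler_norm _)) H1.
  rewrite -/m in mt.
  have H2 : (m - t) * (`|M + e| + `|L| + 1) <= k.
    by rewrite -ler_pdivlMr//; lra.
  have H3 : - (M + e) * (m - t) <= `|M + e| * (m - t).
    by rewrite ler_wpM2r ?subr_ge0// -normrN ler_norm.
  have H4 : L * (m - t) <= `|L| * (m - t) by rewrite ler_wpM2r ?subr_ge0// ler_norm.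
  lra.
have [mlt|hm] := ltP m h; last first.
  by rewrite (_ : h = m)//; apply/eqP; rewrite eq_le hm mh.
have [|d d0 Hd] := slopeF m _ e e0; first by rewrite m0.
pose s := Num.min d (h - m) / 2.
have mn0 : 0 < Num.min d (h - m) by rewrite lt_min d0 subr_gt0.
have s0 : 0 < s by rewrite divr_gt0.
have smin : s < Num.min d (h - m) by rewrite /s; lra.
move: smin; rewrite lt_min => /andP[sd sh].
have : A (m + s).
  split; first by apply/andP; split; lra.
  by have := Hd s; rewrite s0 sd => /(_ isT); lra.
move/(ub_le_sup (proj2 Aub)); rewrite -/m; lra.
Qed.

Section Semigroup.
Context {R : realType} {E : countType}.
Variables (Q : E -> E -> R) (p0 : E -> R) (P : R -> option E -> option E -> R).
Implicit Types (s t h C e : R).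
Hypothesis hP : is_semigroup Q p0 P.

Definition sg t (f : option E -> R) x := expect (P t x) f.

Lemma is_prob_sg t x : 0 <= t -> is_prob (P t x).
Proof. by case: hP => h _ _ _; exact: h. Qed.

Lemma is_subprob_sg t x : 0 <= t -> is_subprob (P t x).
Proof. by move=> t0; exact/is_prob_subprob/is_prob_sg. Qed.

Lemma sg_bounded t f C : 0 <= t -> 0 <= C -> (forall x, `|f x| <= C) ->
  forall x, `|sg t f x| <= C.
Proof. by move=> t0 C0 fC x; apply: ler_norm_expect => //; exact: is_subprob_sg. Qed.

Lemma bounded_on_sg t f : 0 <= t -> bounded_on f -> bounded_on (sg t f).
Proof.
by move=> t0 /bounded_onP[C C0 fC]; exists C => x; exact: sg_bounded.
Qed.

Lemma sgB t f g x : 0 <= t -> bounded_on f -> bounded_on g ->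
  sg t (fun y => f y - g y) x = sg t f x - sg t g x.
Proof. by move=> t0; apply: expectB; exact: is_subprob_sg. Qed.

Lemma sgD s t f x : 0 <= s -> 0 <= t -> bounded_on f ->
  sg (s + t) f x = sg s (sg t f) x.
Proof.
move=> s0 t0 bf; rewrite /sg -(@expect_mixture _ _ _ (P s x) (P t))//; last 2 first.
- exact: is_subprob_sg.
- by move=> y; exact: is_subprob_sg.
suff -> : P (s + t) x = mixture (P s x) (P t) by [].
by apply/funext => z; case: hP => _ _ h _; rewrite (h s t x z s0 t0).
Qed.

Lemma sg0 f x : sg 0 f x = f x.
Proof.
rewrite /sg /expect -[RHS](dsum_delta x); apply: eq_dsum => y.
by case: hP => _ -> _ _; rewrite eq_sym; case: eqP => [->|_]; rewrite ?mul1r ?mul0r.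
Qed.

Lemma sg_right_slope f x e : bounded_on f -> 0 < e -> exists2 d, 0 < d &
  forall h, 0 < h < d -> `|sg h f x - f x - h * gen Q p0 f x| <= e * h.
Proof.
move=> bf e0; case: hP => _ _ _ /(_ f x bf) /cvgrPdist_le /(_ e e0).
move=> [d /= d0 Hd]; exists d => // h /andP[h0 hd].
have := Hd h; rewrite /= sub0r normrN gtr0_norm// hd h0 => /(_ isT isT).
rewrite -/(sg h f x) distrC => Hh.
have -> : sg h f x - f x - h * gen Q p0 f x =
    (h^-1 * (sg h f x - f x) - gen Q p0 f x) * h by field; rewrite gt_eqF.
by rewrite normrM (gtr0_norm h0) ler_pM2r.
Qed.

(** Only the intermediate state x is kept in the Chapman-Kolmogorov sum. *)
Lemma stay_superM s t x : 0 <= s -> 0 <= t -> P s x x * P t x x <= P (s + t) x x.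
Proof.
move=> s0 t0; case: (hP) => _ _ -> // _.
have pt y : 0 <= P t y x <= 1 by exact/subprob_le1/is_subprob_sg.
rewrite -[X in X * _](expect_point (P s x)) mulrC -expectZ; apply: le_expect => //.
- exact: is_subprob_sg.
- exact/bounded_onZ/bounded_on_bool.
- by apply: bounded_on01 => y; exact: pt.
- by move=> y; case: eqP => [->|_]; rewrite ?mulr1 ?mulr0//; case/andP: (pt y).
Qed.

(* [1 - P_t(x,x)] is nonnegative and subadditive in [t], so it is bounded by
   its right slope at 0 times [t]. *)
Lemma leave_le t x : 0 <= t ->
  1 - P t x x <= - gen Q p0 (fun y => (y == x)%:R) x * t.
Proof.
move=> t0; pose D s := 1 - P s x x.
have D01 s : 0 <= s -> 0 <= P s x x <= 1.
  by move=> s0; exact/subprob_le1/is_subprob_sg.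
have D0 : D 0 = 0 by rewrite /D; case: hP => _ -> _ _; rewrite eqxx subrr.
have Dn n s : 0 <= s -> D (n%:R * s) <= n%:R * D s.
  move=> s0; elim: n => [|n IH]; first by rewrite !mul0r D0.
  rewrite -natr1 !mulrDl !mul1r (le_trans _ (lerD IH (lexx _)))// /D.
  have ns0 : 0 <= n%:R * s by rewrite mulr_ge0.
  have := stay_superM x ns0 s0.
  (* For a, b in [0, 1], (1 - a) (1 - b) >= 0 gives 1 - a b <= (1 - a) + (1 - b). *)
  by move: (D01 _ ns0) (D01 _ s0) => /andP[a0 a1] /andP[b0 b1]; nra.
have [->|tn0] := eqVneq t 0; first by rewrite mulr0 -/(D 0) D0.
have tp : 0 < t by rewrite lt_neqAle eq_sym tn0.
pose f : option E -> R := fun y => (y == x)%:R.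
have bf : bounded_on f by exact: bounded_on_bool.
apply/ler_addgt0Pr => e e0.
(* An error e / t per unit of time adds up to e over the n + 1 steps of length t / (n + 1). *)
have [d d0 Hd] := sg_right_slope x bf (divr_gt0 e0 tp).
have [n nd] : exists n, t / n.+1%:R < d.
  exists (Num.truncn (t / d)); rewrite ltr_pdivrMr// mulrC -ltr_pdivrMr//.
  exact: truncnS_gt.
have h0 : 0 < t / n.+1%:R by rewrite divr_gt0.
have := Hd (t / n.+1%:R); rewrite h0 nd => /(_ isT).
set h := t / _ in h0 *.
have -> : sg h f x = P h x x by exact: expect_point.
rewrite {1}/f eqxx mulr1n ler_norml => /andP[Hl _].
have H2 : n.+1%:R * h = t by rewrite /h mulrCA divff ?mulr1 ?pnatr_eq0.
have := Dn n.+1 _ (ltW h0); rewrite H2 => /le_trans; apply.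
have H3 : e = n.+1%:R * (e / t * h) by rewrite mulrCA H2 divfK ?gt_eqF.
rewrite -{1}H2 {1}H3 mulrCA -mulrDr ler_wpM2l// /D -/f; lra.
Qed.

(** The integrand f y - f x vanishes at y = x and is at most 2 C elsewhere, so only the mass away
    from x counts. *)
Lemma sg_sub_le f C h x : 0 <= h -> (forall y, `|f y| <= C) ->
  `|sg h f x - f x| <= 2 * C * (1 - P h x x).
Proof.
move=> h0 fC; have pPx := is_subprob_sg x h0.
have bf : bounded_on f by exists C.
have bc (c : R) : bounded_on (fun _ : option E => c) by exact: bounded_on_cst.
have bd : bounded_on (fun y : option E => (y == x)%:R : R) by exact: bounded_on_bool.
rewrite -[X in _ - X](expect_cst (f x) (is_prob_sg x h0)) -expectB//.
pose g (y : option E) : R := 1 - (y == x)%:R.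
have bg : bounded_on g by exact: bounded_onB.
have -> : 1 - P h x x = expect (P h x) g.
  by rewrite expectB// expect_cst ?expect_point//; exact: is_prob_sg.
rewrite -expectZ.
have bfx : bounded_on (fun y => f y - f x) by exact: bounded_onB.
have H y : `|f y - f x| <= 2 * C * g y.
  rewrite /g; case: eqP => [->|_]; first by rewrite !subrr normr0 mulr0.
  rewrite subr0 mulr1 mulr2n mulrDl mul1r.
  by rewrite (le_trans (ler_normB _ _))// lerD.
rewrite ler_norml -mulN1r -!expectZ !le_expect//; try exact: bounded_onZ.
- by move=> y; rewrite (le_trans (ler_norm _)).
- exact/bounded_onZ/bounded_onZ.
- by move=> y; rewrite mulN1r lerNl (le_trans _ (H y))// -normrN ler_norm.
Qed.

End Semigroup.

(** * Sums over F of functions vanishing at the absorbing point *)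

Section Option.
Context {R : realType} {E : countType}.

Lemma esum_option (a : option E -> \bar R) : a None = 0%E ->
  (\esum_(x in [set: option E]) a x = \esum_(i in [set: E]) a (Some i))%E.
Proof.
move=> a0; rewrite -(esum_image [set: E] Some); last by move=> i j _ _ [].
rewrite [RHS]esum_mkcond; apply: eq_esum => -[i|] _; last by rewrite a0 if_same.
by rewrite mem_set//; exists i.
Qed.

Lemma dsum_option (u : option E -> R) : u None = 0 -> dsum u = dsum (u \o Some).
Proof. by move=> u0; rewrite /dsum !esum_option// u0 ?oppr0 maxxx. Qed.

Lemma is_subprob_some (m : option E -> R) : is_subprob m -> is_subprob (m \o Some).
Proof.
move=> [m0 m1]; split=> [i|]; first exact: m0.
apply: le_trans m1.
rewrite -(esum_option (a := fun x => if x is Some _ then (m x)%:E else 0%E))//.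
by apply: le_esum => -[i|] _; rewrite ?lee_fin.
Qed.

Lemma expect_ext0 (m : option E -> R) (f : E -> R) :
  expect m (ext0 f) = expect (m \o Some) f.
Proof. by rewrite /expect dsum_option//= mulr0. Qed.

Lemma bounded_on_ext0 (f : E -> R) : bounded_on f -> bounded_on (ext0 f).
Proof. by move=> /bounded_onP[C C0 fC]; exists C => -[i|]//=; rewrite normr0. Qed.

Lemma ler_norm_wdsum (w u : E -> R) C : asummable w -> (forall i, 0 <= w i) ->
  (forall i, `|u i| <= C) -> `|dsum (fun i => w i * u i)| <= C * dsum w.
Proof.
move=> sw w0 uC.
have H i : `|w i * u i| <= C * w i by rewrite normrM ger0_norm// mulrC ler_wpM2r.
have sC := asummableZ C sw; have sH := le_asummable H sC.
rewrite -dsumZ (le_trans (ler_norm_dsum sH))// le_dsum//.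
by apply: (le_asummable _ sC) => i; rewrite normr_id.
Qed.

Lemma asummable_wdsum (w u : E -> R) : asummable w -> (forall i, 0 <= w i) ->
  bounded_on u -> asummable (fun i => w i * u i).
Proof.
move=> sw w0 [C uC]; apply: (le_asummable _ (asummableZ C sw)) => i.
by rewrite normrM ger0_norm// mulrC ler_wpM2r.
Qed.

End Option.

Section BoundedRates.
Context {R : realType} {E : countType}.
Variables (Q : E -> E -> R) (p0 : E -> R) (P : R -> option E -> option E -> R).
Implicit Types (s t h C e : R).

(** Zeroing the diagonal leaves the generator unchanged, since f j - f i = 0 there, and gives
    nonnegative summable weights. *)
Definition off i j := if j == i then 0 else Q i j.

Variables (qM pM : R).
Hypothesis hP : is_semigroup Q p0 P.
Hypothesis off_ge0 : forall i j, 0 <= off i j.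
Hypothesis off_sum : forall i, asummable (off i).
Hypothesis off_le : forall i, dsum (off i) <= qM.
Hypothesis p0_ge0 : forall i, 0 <= p0 i.
Hypothesis p0_le : forall i, p0 i <= pM.
Variable x0 : E.

Local Notation sg := (sg P).

(** A bound for the norm of the generator on bounded functions: death and jump rates total at most
    [pM + qM], and each multiplies a difference of two values. *)
Definition speed := 2 * (pM + qM).

Lemma genE f i : gen Q p0 f (Some i) =
  p0 i * (f None - f (Some i)) + dsum (fun j => off i j * (f (Some j) - f (Some i))).
Proof.
congr (_ + _); apply: eq_dsum => j; rewrite /off /=.
by have [->|//] := eqVneq j i; rewrite subrr !mulr0.
Qed.

Let speed0 : 0 <= speed.
Proof.
rewrite mulr_ge0// addr_ge0//; first exact: le_trans (p0_ge0 x0) (p0_le x0).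
by apply: le_trans (off_le x0); apply: dsum_ge0.
Qed.

Lemma gen_lip f g C x : bounded_on f -> bounded_on g ->
  (forall y, `|f y - g y| <= C) -> `|gen Q p0 f x - gen Q p0 g x| <= speed * C.
Proof.
move=> bf bg fgC.
have C0 : 0 <= C by apply: le_trans (fgC None).
case: x => [i|]; last by rewrite subrr normr0 mulr_ge0.
have bS (k : option E -> R) : bounded_on k ->
    bounded_on (fun j => k (Some j) - k (Some i)).
  move=> [D kD]; exists (D + D) => j.
  by rewrite (le_trans (ler_normB _ _))// lerD.
rewrite !genE opprD addrACA -mulrBr -dsumB; try exact/asummable_wdsum/bS.
pose d y := f y - g y; have dC : forall y, `|d y| <= C := fgC.
have ddC y z : `|d y - d z| <= 2 * C.
  by rewrite (le_trans (ler_normB _ _))// mulr2n mulrDl mul1r lerD.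
rewrite (_ : f None - _ - _ = d None - d (Some i)); last by rewrite /d; ring.
rewrite (_ : dsum _ = dsum (fun j => off i j * (d (Some j) - d (Some i)))); last first.
  by apply: eq_dsum => j; rewrite /d; ring.
rewrite (le_trans (ler_normD _ _))//.
rewrite (_ : speed * C = pM * (2 * C) + (2 * C) * qM); last by rewrite /speed; ring.
rewrite lerD//.
  by rewrite normrM ger0_norm// ler_pM.
rewrite (le_trans (ler_norm_wdsum (C := 2 * C) _ _ _))//.
by rewrite ler_wpM2l// mulr_ge0.
Qed.

Lemma bounded_on_delta x : bounded_on (fun y : option E => (y == x)%:R : R).
Proof. exact: bounded_on_bool. Qed.

Lemma gen_cst0 x : gen Q p0 (fun=> 0) x = 0.
Proof.
case: x => [i|//]; rewrite genE subrr mulr0 add0r.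
rewrite (@eq_dsum _ _ _ (fun j => 0 * off i j)) ?dsumZ ?mul0r// => j /=.
by rewrite mulr0 mul0r.
Qed.

Lemma leave_le_speed t x : 0 <= t -> 1 - P t x x <= speed * t.
Proof.
move=> t0; rewrite (le_trans (leave_le hP x t0))// ler_wpM2r//.
rewrite -[speed]mulr1 (le_trans (ler_norm _))// normrN.
rewrite -[X in `|X|]subr0 -(gen_cst0 x).
apply: gen_lip => //; [exact: bounded_on_delta|exact: bounded_on_cst|].
by move=> y; rewrite subr0; case: eqP => _; rewrite ?normr1 ?normr0.
Qed.

(** The increment is P_t applied to P_h f - f, which is small by the bound on leaving a state, and
    P_t does not increase the sup norm. *)
Lemma sg_lip f C t h x : 0 <= t -> 0 <= h -> (forall y, `|f y| <= C) ->
  `|sg (t + h) f x - sg t f x| <= 2 * C * speed * h.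
Proof.
move=> t0 h0 fC; have C0 : 0 <= C by apply: le_trans (fC None).
have bf : bounded_on f by exists C.
rewrite (sgD hP)// -(sgB hP)//; last exact: bounded_on_sg hP _ _ h0 bf.
apply: (sg_bounded hP) => //.
  by apply: mulr_ge0 => //; apply: mulr_ge0 => //; apply: mulr_ge0.
move=> y; rewrite (le_trans (sg_sub_le hP y h0 fC))// -[leRHS]mulrA ler_wpM2l ?mulr_ge0//.
exact: leave_le_speed.
Qed.

(** The function P_t f(x) - t G f(x) has right derivative G(P_t f)(x) - G f(x), which for t < h is
    at most [speed] times 2 C [speed] h in absolute value. The right-slope inequality, applied with
    both signs, integrates this to order h^2. *)
Lemma sg_expansion f C h x : 0 <= h -> (forall y, `|f y| <= C) ->
  `|sg h f x - f x - h * gen Q p0 f x| <= 2 * speed ^+ 2 * C * h ^+ 2.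
Proof.
move=> h0 fC; have C0 : 0 <= C by apply: le_trans (fC None).
have bf : bounded_on f by exists C.
suff H (b : bool) : (-1) ^+ b * (sg h f x - f x - h * gen Q p0 f x) <=
    2 * speed ^+ 2 * C * h ^+ 2.
  rewrite ler_norml; have := H true; have := H false.
  by rewrite expr0 expr1 mul1r mulN1r lerNl => -> ->.
pose F t := (-1) ^+ b * (sg t f x - t * gen Q p0 f x).
have leb (y : R) : (-1) ^+ b * y <= `|y|.
  by rewrite (le_trans (ler_norm _))// normrM normr_sign mul1r.
have := @le_of_right_slope R F (2 * C * speed + `|gen Q p0 f x|)
  (2 * speed ^+ 2 * C * h) h h0.
rewrite /F -mulrBr mul0r subr0 (sg0 hP) addrAC => H; rewrite (le_trans (H _ _))//.
- move=> s t s0 t0; rewrite -mulrBr normrM normr_sign mul1r.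
  rewrite (_ : _ - _ = (sg (s + t) f x - sg s f x) - t * gen Q p0 f x); last by ring.
  rewrite (le_trans (ler_normB _ _))// mulrDl lerD//; first exact: sg_lip.
  by rewrite normrM ger0_norm// mulrC.
- move=> t /andP[t0 th] e e0.
  have bt := bounded_on_sg hP t0 bf.
  have [d d0 Hd] := sg_right_slope hP x bt e0; exists d => // s sd.
  have /andP[s0 _] := sd; have {}Hd := Hd s sd.
  (* The short step s is taken first, so that the slope at time 0 is applied to the bounded function
     P_t f. *)
  rewrite -mulrBr (le_trans (leb _))// [t + s]addrC (sgD hP) ?(ltW s0)//.
  set a := sg s _ x in Hd *.
  rewrite (_ : _ - _ = (a - sg t f x - s * gen Q p0 (sg t f) x)
     + s * (gen Q p0 (sg t f) x - gen Q p0 f x)); last by ring.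
  rewrite (le_trans (ler_normD _ _))// mulrDl addrC lerD//.
  rewrite normrM (gtr0_norm s0) mulrC ler_wpM2r ?(ltW s0)//.
  have -> : 2 * speed ^+ 2 * C * h = speed * (2 * C * speed * h) by ring.
  apply: gen_lip => // y; rewrite -[X in _ - X](sg0 hP f y) -[t]add0r.
  rewrite (le_trans (sg_lip _ _ _ fC))// ler_wpM2l//; last exact: ltW.
  by apply: mulr_ge0 => //; apply: mulr_ge0.
- by rewrite -!mulrA -expr2.
Qed.

(** * The killed semigroup and the conditioned laws *)

Definition killed t f i := sg t (ext0 f) (Some i).

Definition kernel t i j := P t (Some i) (Some j).

Definition killed_gen (f : E -> R) i :=
  - (p0 i * f i) + dsum (fun j => off i j * (f j - f i)).

Lemma is_subprob_kernel t i : 0 <= t -> is_subprob (kernel t i).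
Proof. by move=> t0; exact/is_subprob_some/(is_subprob_sg hP). Qed.

Lemma killedE t f i : killed t f i = expect (kernel t i) f.
Proof. exact: expect_ext0. Qed.

(** The generator vanishes at 0, so the bound on leaving a state shows that no mass leaves 0.
    Functions vanishing at 0 are thus preserved, which makes [killed] a semigroup. *)
Lemma sg_ext0_none t f : 0 <= t -> bounded_on f -> sg t (ext0 f) None = 0.
Proof.
move=> t0 /bounded_on_ext0 [C fC]; apply/eqP; rewrite -normr_le0.
have := sg_sub_le hP None t0 fC; rewrite subr0 => /le_trans; apply.
have C0 : 0 <= C by apply: le_trans (fC None).
have := leave_le hP None t0; rewrite /gen oppr0 mul0r => Hle.
by rewrite mulr_ge0_le0// mulr_ge0.
Qed.

Lemma sg_ext0 t f : 0 <= t -> bounded_on f -> sg t (ext0 f) = ext0 (killed t f).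
Proof. by move=> t0 bf; apply/funext => -[i|] /=; [exact: erefl|rewrite sg_ext0_none]. Qed.

Lemma killedD s t f i : 0 <= s -> 0 <= t -> bounded_on f ->
  killed (s + t) f i = killed s (killed t f) i.
Proof.
move=> s0 t0 bf; rewrite {1}/killed (sgD hP)//; last exact: bounded_on_ext0.
by rewrite sg_ext0.
Qed.

Lemma bounded_on_killed t f : 0 <= t -> bounded_on f -> bounded_on (killed t f).
Proof.
move=> t0 /bounded_on_ext0/(bounded_on_sg hP t0)[C HC].
by exists C => i; exact: HC.
Qed.

Lemma killed_expansion f h i : 0 <= h -> (forall j, `|f j| <= 1) ->
  `|killed h f i - f i - h * killed_gen f i| <= 2 * speed ^+ 2 * h ^+ 2.
Proof.
move=> h0 f1; have H : forall x, `|ext0 f x| <= 1 by case=> //=; rewrite normr0.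
have := sg_expansion (Some i) h0 H.
by rewrite genE/= sub0r mulrN mulr1.
Qed.

Lemma killed_gen1 i : killed_gen (fun=> 1) i = - p0 i.
Proof.
rewrite /killed_gen mulr1 (@eq_dsum _ _ _ (fun j => 0 * off i j)); last first.
  by move=> j; rewrite subrr mulr0 mul0r.
by rewrite dsumZ mul0r addr0.
Qed.

Lemma killed_gen_indic (A : pred E) i : ~~ A i ->
  killed_gen (fun j => (A j)%:R) i = dsum (fun j => off i j * (A j)%:R).
Proof.
move=> Ai; rewrite /killed_gen (negbTE Ai) mulr0 oppr0 add0r.
by apply: eq_dsum => j; rewrite addr0.
Qed.

(* The two marginals are compared through the set [A] where the first kernel is
   the smaller one: the common mass of [kernel h x] and [kernel h y] is
   [killed h 1_A x + killed h 1_(~A) y], which is at least [lam h + o(h)]. *)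
Lemma killed_osc t g (c : R) x y (A := fun j => kernel t x j <= kernel t y j) :
  0 <= t -> 0 <= c <= 1 -> (forall j, - c <= g j <= 1 - c) ->
  killed t g x - killed t g y <=
    (1 - c) * killed t (fun=> 1) x + c * killed t (fun=> 1) y
    - (killed t (fun j => (A j)%:R) x + killed t (fun j => (~~ A j)%:R) y).
Proof.
move=> t0 /andP[c0 c1] gc; rewrite !killedE.
have px := is_subprob_kernel x t0; have py := is_subprob_kernel y t0.
have bg : bounded_on g.
  exists 1 => j; have /andP[g0 g1] := gc j.
  by rewrite ler_norml; apply/andP; split; lra.
have bA : bounded_on (fun j => (A j)%:R : R) by exact: bounded_on_bool.
have b1 : bounded_on (fun _ : E => 1 : R) by exact: bounded_on_cst.
have bc : bounded_on (fun _ : E => (1 - c) * 1 : R) by exact: bounded_onZ.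
have bgc : bounded_on (fun j => g j - (1 - c) * 1) by exact: bounded_onB.
have bphi : bounded_on (fun j => g j - (1 - c) * 1 + (A j)%:R) by exact: bounded_onD.
(* On A the integrand is g + c >= 0 and [kernel t x] is the smaller weight; off A it is g - (1 - c)
   <= 0 and [kernel t x] is the larger one. The inequality therefore holds pointwise. *)
have : expect (kernel t x) (fun j => g j - (1 - c) * 1 + (A j)%:R) <=
       expect (kernel t y) (fun j => g j - (1 - c) * 1 + (A j)%:R).
  apply: le_dsum; try exact: asummable_expect.
  move=> j; have /andP[g0 g1] := gc j; rewrite /A.
  case: (leP (kernel t x j) (kernel t y j)) => hj /=.
    by rewrite ler_wpM2r//; lra.
  rewrite -subr_ge0 -mulrBl mulr_le0//; first by rewrite subr_le0 ltW.
  lra.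
rewrite (expectD px bgc bA) (expectB px bg bc) (expectD py bgc bA) (expectB py bg bc) !expectZ.
have -> : expect (kernel t y) (fun j => (~~ A j)%:R) =
    expect (kernel t y) (fun=> 1) - expect (kernel t y) (fun j => (A j)%:R).
  rewrite -expectB//; apply: eq_expect => j.
  by case: (A j); rewrite ?subrr ?subr0.
lra.
Qed.

Variables (pm lam : R).
Hypothesis pm_le : forall i, pm <= p0 i.
(** The form in which lambda meets [killed_osc]: for a set A containing y but not x, the rate from x
    into A plus that from y out of A. Minimising over A puts each third state j on its cheaper side,
    which yields Q x j /\ Q y j. *)
Hypothesis lam_le : forall x y, x != y -> forall A : pred E, ~~ A x -> A y ->
  lam <= dsum (fun j => off x j * (A j)%:R) + dsum (fun j => off y j * (~~ A j)%:R).

(** The first smallness condition makes each expansion error at most e h. The second makes diagonal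
    entries at least 3/4 and off-diagonal ones at most 1/4, so the comparison set contains y and not
    x. The third keeps the oscillation bound nonnegative when x = y. Of the 3 e, one comes from the
    survival probabilities and one from each of the two indicators. *)
Lemma killed_small_time e h : 0 < e -> 0 < h -> 2 * speed ^+ 2 * h <= e ->
  4 * speed * h <= 1 -> 2 * `|lam + pm - 3 * e| * h <= 1 ->
  (forall i, 1 - (pM + e) * h <= killed h (fun=> 1) i) /\
  (forall g (c : R), 0 <= c <= 1 -> (forall j, - c <= g j <= 1 - c) -> forall x y,
     killed h g x - killed h g y <= 1 - (lam + pm - 3 * e) * h).
Proof.
move=> e0 h0 he hs hl; have h0' := ltW h0.
have exp f i : (forall j, `|f j| <= 1) ->
    `|killed h f i - f i - h * killed_gen f i| <= e * h.
  move=> f1; rewrite (le_trans (killed_expansion i h0' f1))//.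
  by rewrite (expr2 h) mulrA ler_wpM2r.
have exp1 i : 1 - (p0 i + e) * h <= killed h (fun=> 1) i <= 1 - (p0 i - e) * h.
  have := exp (fun=> 1) i; rewrite normr1 killed_gen1 ler_norml.
  by move=> /(_ (fun=> lexx _)) /andP[? ?]; apply/andP; split; lra.
have expA (A : pred E) i : ~~ A i ->
    (dsum (fun j => off i j * (A j)%:R) - e) * h <= killed h (fun j => (A j)%:R) i.
  move=> Ai; have := exp (fun j => (A j)%:R) i.
  rewrite killed_gen_indic// (negbTE Ai) mulr0n subr0 ler_norml => H.
  have /H/andP[? _] : forall j, `|(A j)%:R : R| <= 1.
    by move=> j; case: (A j); rewrite ?normr1 ?normr0.
  lra.
split=> [i|g c c01 gc x y].
  have /andP[+ _] := exp1 i; apply: le_trans.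
  by rewrite lerD2l lerN2 ler_wpM2r// lerD2r.
have [->|xy] := eqVneq x y.
  rewrite subrr subr_ge0 (le_trans (ler_norm _))// normrM (gtr0_norm h0).
  have : 0 <= `|lam + pm - 3 * e| * h by rewrite mulr_ge0.
  lra.
have diag i : 3 / 4 <= kernel h i i.
  have : 1 - kernel h i i <= speed * h by exact: leave_le_speed.
  lra.
have offd i j : i != j -> kernel h i j <= 1 / 4.
  move=> ij; have pi := is_subprob_sg hP (Some i) h0'.
  have : P h (Some i) (Some i) + P h (Some i) (Some j) <= 1.
    rewrite -(expect_point (P h (Some i)) (Some i)) -(expect_point (P h (Some i)) (Some j)).
    rewrite -expectD//; try exact: bounded_on_bool.
    pose f (k : option E) : R := (k == Some i)%:R + (k == Some j)%:R.
    have f01 k : 0 <= f k <= 1.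
      have : ~~ ((k == Some i) && (k == Some j)).
        by apply/negP => /andP[/eqP -> /eqP[/eqP]]; apply/negP.
      by rewrite /f; case: (k == Some i) (k == Some j) => -[]//= _; apply/andP; split; lra.
    by case/andP: (expect_ge0_le1 pi f01).
  have := diag i; rewrite /kernel; lra.
pose A j := kernel h x j <= kernel h y j.
have Ay : A y by rewrite /A (le_trans (offd _ _ xy))// (le_trans _ (diag y))//; lra.
have Ax : ~~ A x.
  rewrite /A -ltNge (le_lt_trans (offd y x _))// 1?eq_sym//.
  by rewrite (lt_le_trans _ (diag x))//; lra.
have := killed_osc x y h0' c01 gc; rewrite -/A.
have nAy : ~~ (predC A) y by rewrite /= Ay.
have := expA A x Ax; have := expA (predC A) y nAy; rewrite /=.
have := lam_le xy Ax Ay.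
set a := dsum _; set b := dsum _; set ka := killed _ _ x; set kb := killed _ _ y.
move=> lamab Hb Ha Hosc.
have /andP[_ sx] := exp1 x; have /andP[_ sy] := exp1 y.
have /andP[c0 c1] := c01.
have Hlam : lam * h <= (a + b) * h by rewrite ler_wpM2r.
have hx : pm * h <= p0 x * h by rewrite ler_wpM2r.
have hy : pm * h <= p0 y * h by rewrite ler_wpM2r.
have sx' : (1 - c) * killed h (fun=> 1) x <= (1 - c) * (1 - (pm - e) * h).
  by rewrite ler_wpM2l//; lra.
have sy' : c * killed h (fun=> 1) y <= c * (1 - (pm - e) * h).
  by rewrite ler_wpM2l//; lra.
lra.
Qed.

(** Over a step h with [speed] h <= 1/2 the process is still at i with probability at least 1/2, and
    such steps are chained. The bound, uniform in i, keeps the survival probability of every initial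
    law positive. *)
Lemma kernel_diag_ge t : 0 <= t -> exists2 z : R, 0 < z & forall i, z <= kernel t i i.
Proof.
move=> t0; pose n := Num.truncn (2 * speed * t); pose h := t / n.+1%:R.
have h0 : 0 <= h by rewrite divr_ge0.
have hs : speed * h <= 1 / 2.
  rewrite /h mulrA ler_pdivrMr//; have : 2 * speed * t < n.+1%:R by exact: truncnS_gt.
  lra.
have tE : t = n.+1%:R * h by rewrite /h mulrCA divff ?mulr1 ?pnatr_eq0.
exists ((1 / 2) ^+ n.+1) => [|i]; first by rewrite exprn_gt0//; lra.
rewrite tE; elim: n.+1 => [|k IH].
  by rewrite expr0 mul0r /kernel; case: hP => _ -> _ _; rewrite eqxx.
rewrite exprSr -[k.+1%:R]natr1 mulrDl [1 * h]mul1r.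
have kh0 : 0 <= k%:R * h by rewrite mulr_ge0.
apply: (le_trans _ (stay_superM hP (Some i) kh0 h0)); apply: ler_pM => //.
by have := leave_le_speed (Some i) h0; lra.
Qed.

Lemma killed1_ge t : 0 <= t ->
  exists2 z : R, 0 < z & forall i, z <= killed t (fun=> 1) i.
Proof.
move=> t0; have [z z0 Hz] := kernel_diag_ge t0; exists z => // i.
rewrite (le_trans (Hz i))// killedE -{1}(expect_point (kernel t i) i) le_expect//.
- exact: is_subprob_kernel.
- exact: bounded_on_bool.
- exact: bounded_on_cst.
- by move=> j; case: (j == i).
Qed.

Definition survival t mu := expect mu (killed t (fun=> 1)).

(** The point masses of mu T_t. [condT] yields only a functional, which cannot serve as a new
    initial law. *)
Definition cond_law t mu j := (survival t mu)^-1 * mixture mu (kernel t) j.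

Lemma killedB t f g i : 0 <= t -> bounded_on f -> bounded_on g ->
  killed t (fun j => f j - g j) i = killed t f i - killed t g i.
Proof. by move=> t0 bf bg; rewrite !killedE expectB//; exact: is_subprob_kernel. Qed.

Lemma bounded_on_killed1 t : 0 <= t -> bounded_on (killed t (fun=> 1)).
Proof. by move=> t0; apply: bounded_on_killed => //; exact: bounded_on_cst. Qed.

Lemma survival_gt0 t mu : 0 <= t -> is_prob mu -> 0 < survival t mu.
Proof.
move=> t0 pmu; have [z z0 Hz] := killed1_ge t0.
rewrite (lt_le_trans z0)// -(expect_cst z pmu) le_expect//.
- exact: is_prob_subprob.
- exact: bounded_on_cst.
- exact: bounded_on_killed1.
Qed.

Lemma expect_cond_law t mu f : 0 <= t -> is_prob mu -> bounded_on f ->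
  expect (cond_law t mu) f = condT P mu t f.
Proof.
move=> t0 pmu bf; rewrite /condT -/(survival t mu) mulrC.
have -> : expect mu (fun y => expect (P t (Some y)) (ext0 f)) =
    expect (mixture mu (kernel t)) f.
  rewrite expect_mixture//; first by apply: eq_expect => i; exact: killedE.
    exact: is_prob_subprob.
  by move=> i; exact: is_subprob_kernel.
by rewrite /expect -dsumZ; apply: eq_dsum => j; rewrite mulrA.
Qed.

Lemma is_prob_cond_law t mu : 0 <= t -> is_prob mu -> is_prob (cond_law t mu).
Proof.
move=> t0 pmu; have Z0 := survival_gt0 t0 pmu.
have pk i : is_subprob (kernel t i) by exact: is_subprob_kernel.
have m0 := mixture_ge0 (is_prob_subprob pmu) pk.
split=> [j|]; first by rewrite mulr_ge0// invr_ge0 ltW.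
rewrite esumZ// ?invr_ge0 1?ltW//.
under eq_esum do rewrite -[mixture _ _ _]mulr1.
rewrite esum_mixture//; [|exact: is_prob_subprob|exact: bounded_on_cst].
rewrite -EFinM; congr EFin; rewrite mulrC.
have -> : expect mu (fun i => expect (kernel t i) (fun=> 1)) = survival t mu.
  by apply: eq_expect => i; rewrite killedE.
by rewrite divff// gt_eqF.
Qed.

(** The factor [survival s mu] divides numerator and denominator alike and cancels, so the nonlinear
    maps T_t inherit the semigroup property. *)
Lemma condT_cond_law s t mu f : 0 <= s -> 0 <= t -> is_prob mu -> bounded_on f ->
  condT P (cond_law s mu) t f = condT P mu (s + t) f.
Proof.
move=> s0 t0 pmu bf.
have b1 : bounded_on (fun _ : E => 1 : R) by exact: bounded_on_cst.
have H g : bounded_on g -> expect (cond_law s mu) (killed t g) =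
    expect mu (killed (s + t) g) / survival s mu.
  move=> bg; rewrite expect_cond_law//; last exact: bounded_on_killed.
  congr (_ / _); apply: eq_expect => i.
  by rewrite killedD.
have Z0 : survival s mu != 0 by rewrite gt_eqF ?survival_gt0.
rewrite /condT (H f bf) (H _ b1) invf_div mulrA divfK//.
Qed.

Lemma cond_lawD s t mu : 0 <= s -> 0 <= t -> is_prob mu ->
  cond_law (s + t) mu = cond_law t (cond_law s mu).
Proof.
move=> s0 t0 pmu; have st0 : 0 <= s + t by rewrite addr_ge0.
have bj (j : E) : bounded_on (fun k => (k == j)%:R : R) by exact: bounded_on_bool.
have ps := is_prob_cond_law s0 pmu.
apply/funext => j; rewrite -[LHS]expect_point -[RHS]expect_point.
by rewrite !expect_cond_law// condT_cond_law.
Qed.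

Lemma cond_law0 mu : is_prob mu -> cond_law 0 mu = mu.
Proof.
move=> pmu; apply/funext => j; rewrite -[LHS]expect_point expect_cond_law//; last first.
  exact: bounded_on_bool.
have k0 f i : killed 0 f i = f i by rewrite /killed (sg0 hP).
rewrite /condT (eq_expect _ (k0 _)) (eq_expect _ (k0 _)) expect_cst// divr1.
exact: expect_point.
Qed.

(** * Contraction and quasi-stationary distribution *)

(** Of the 5 e, three come from the oscillation, one from the lower bound w on survival, and one
    absorbs the cross term (pM + e) r h^2 in w (1 - r h). The threshold is independent of the laws,
    so the step can be iterated. *)
Lemma cond_law_contraction_small e : 0 < e -> exists2 h0, 0 < h0 &
  forall h, 0 < h < h0 -> forall mu nu D, is_prob mu -> is_prob nu -> tv_le mu nu D ->
    tv_le (cond_law h mu) (cond_law h nu) (expR (- (lam + pm - pM - 5 * e) * h) * D).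
Proof.
move=> e0; set r := lam + pm - pM - 5 * e.
(* Each summand of N is the reciprocal of one upper limit on h; for h < 1 / N all of them hold at
   once. *)
pose N := 2 * speed ^+ 2 / e + 4 * speed + 2 * `|lam + pm - 3 * e| + 2 * `|pM + e|
          + `|(pM + e) * r| / e + 1.
have sq0 : 0 <= 2 * speed ^+ 2 / e by apply: mulr_ge0; [apply: mulr_ge0 => //; exact: exprn_ge0|rewrite invr_ge0 ltW].
have s4 : 0 <= 4 * speed by apply: mulr_ge0.
have n1 : 0 <= `|lam + pm - 3 * e| by [].
have n2 : 0 <= `|pM + e| by [].
have n3 : 0 <= `|(pM + e) * r| / e by rewrite mulr_ge0 ?invr_ge0 ?(ltW e0).
have N0 : 0 < N by rewrite /N; lra.
exists N^-1 => [|h /andP[h0 hN] mu nu D pmu pnu Hd]; first by rewrite invr_gt0.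
have Nh : N * h < 1 by rewrite -ltr_pdivlMl// mulr1.
have small c : c <= N -> c * h <= 1.
  by move=> cN; rewrite (le_trans _ (ltW Nh))// ler_wpM2r// ltW.
have c1 : 2 * speed ^+ 2 * h <= e.
  have : 2 * speed ^+ 2 / e * h <= 1 by apply: small; rewrite /N; lra.
  by rewrite mulrAC ler_pdivrMr// mul1r.
have c2 : 4 * speed * h <= 1 by apply: small; rewrite /N; lra.
have c3 : 2 * `|lam + pm - 3 * e| * h <= 1 by apply: small; rewrite /N; lra.
have c4 : 2 * `|pM + e| * h <= 1 by apply: small; rewrite /N; lra.
have c5 : `|(pM + e) * r| * h <= e.
  have : `|(pM + e) * r| / e * h <= 1 by apply: small; rewrite /N; lra.
  by rewrite mulrAC ler_pdivrMr// mul1r.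
have [surv osc] := killed_small_time e0 h0 c1 c2 c3.
pose w := 1 - (pM + e) * h; pose k := 1 - (lam + pm - 3 * e) * h.
have absle (y : R) : 2 * `|y| * h <= 1 -> y * h <= 1 / 2.
  move=> H; have : y * h <= `|y| * h by rewrite ler_wpM2r ?(ltW h0) ?ler_norm.
  lra.
have w0 : 0 < w by rewrite /w; have := absle _ c4; lra.
have k0 : 0 < k by rewrite /k; have := absle _ c3; lra.
have kw : k <= w * (1 - r * h).
  have H : - ((pM + e) * r) * h <= e.
    by rewrite (le_trans _ c5)// ler_wpM2r ?(ltW h0)// -normrN ler_norm.
  have H' : - ((pM + e) * r) * h * h <= e * h by rewrite ler_wpM2r// ltW.
  by rewrite /k /w /r; rewrite /r in H'; nra.
have h0' := ltW h0.
move=> f f01; have bf := bounded_on01 f01.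
have b1 : bounded_on (fun _ : E => 1 : R) by exact: bounded_on_cst.
pose c := expect (cond_law h nu) f.
have c01 : 0 <= c <= 1.
  by apply: expect_ge0_le1 => //; exact/is_prob_subprob/is_prob_cond_law.
pose g (j : E) := f j - c * 1.
have bg : bounded_on g by apply: bounded_onB => //; exact: bounded_onZ.
have gc j : - c <= g j <= 1 - c.
  by have /andP[? ?] := f01 j; rewrite /g mulr1; apply/andP; split; lra.
have Zmu := survival_gt0 h0' pmu; have Znu := survival_gt0 h0' pnu.
have Eg m : is_prob m -> expect m (killed h g) =
    expect m (killed h f) - c * survival h m.
  move=> pm'; rewrite /survival -expectZ -expectB; last 3 first.
  - exact: is_prob_subprob.
  - exact: bounded_on_killed.
  - exact/bounded_onZ/bounded_on_killed1.
  apply: eq_expect => i; rewrite /g killedB//; last exact: bounded_onZ.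
  by congr (_ - _); rewrite !killedE expectZ.
have condE m : is_prob m ->
    expect (cond_law h m) f = expect m (killed h f) / survival h m.
  by move=> pm'; rewrite expect_cond_law.
have nug : expect nu (killed h g) = 0.
  by rewrite Eg// /c condE// divfK ?subrr// gt_eqF.
have wZ : w <= survival h mu.
  rewrite -(expect_cst w pmu) le_expect//.
  - exact: is_prob_subprob.
  - exact: bounded_on_cst.
  - exact: bounded_on_killed1.
have D0 := tv_le_ge0 Hd.
have := expect_osc x0 pmu pnu Hd k0 (bounded_on_killed h0' bg) (osc g c c01 gc).
rewrite nug subr0 Eg// => Hmain.
rewrite -/c condE//.
have -> : expect mu (killed h f) / survival h mu - c =
    (expect mu (killed h f) - c * survival h mu) / survival h mu.
  by rewrite [RHS]mulrBl mulfK// gt_eqF.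
rewrite ler_pdivrMr// (le_trans Hmain)//.
have rh0 : 0 < 1 - r * h.
  by rewrite -(pmulr_rgt0 _ w0) (lt_le_trans k0).
apply: (@le_trans _ _ (w * (1 - r * h) * D)); first by rewrite ler_wpM2r.
rewrite [leRHS]mulrAC ler_wpM2r// mulrC ler_pM ?(ltW w0) ?(ltW rh0)//.
by have := @expR_ge1Dx R (- r * h); rewrite mulNr.
Qed.

Lemma cond_law_contraction t mu nu D : 0 <= t ->
  is_prob mu -> is_prob nu -> tv_le mu nu D ->
  tv_le (cond_law t mu) (cond_law t nu) (expR (- (lam + pm - pM) * t) * D).
Proof.
move=> t0 pmu pnu Hd; set r := lam + pm - pM.
have [tz|tn0] := eqVneq t 0.
  by rewrite tz !cond_law0// mulr0 expR0 mul1r.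
have tp : 0 < t by rewrite lt_neqAle eq_sym tn0.
have He e : 0 < e ->
    tv_le (cond_law t mu) (cond_law t nu) (expR (- (r - 5 * e) * t) * D).
  move=> e0; have [h0 h00 Hh] := cond_law_contraction_small e0.
  pose n := Num.truncn (t / h0); pose h := t / n.+1%:R.
  have hp : 0 < h by rewrite divr_gt0.
  have hh0 : h < h0.
    by rewrite ltr_pdivrMr// mulrC -ltr_pdivrMr//; exact: truncnS_gt.
  have tE : t = n.+1%:R * h by rewrite /h mulrCA divff ?mulr1 ?pnatr_eq0.
  rewrite tE; elim: n.+1 => [|m IH].
    by rewrite mul0r !cond_law0// mulr0 expR0 mul1r.
  have -> : m.+1%:R * h = m%:R * h + h by rewrite -natr1 mulrDl mul1r.
  have mh0 : 0 <= m%:R * h by rewrite mulr_ge0// ltW.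
  rewrite !(cond_lawD mh0 (ltW hp))//.
  have -> : expR (- (r - 5 * e) * (m%:R * h + h)) * D =
      expR (- (r - 5 * e) * h) * (expR (- (r - 5 * e) * (m%:R * h)) * D).
    by rewrite mulrA -expRD; congr (expR _ * _); ring.
  by apply: Hh => //; [rewrite hp|exact: is_prob_cond_law|exact: is_prob_cond_law].
move=> f f01; set X := expect _ _ - _; apply/ler_addgt0Pr => d d0.
have [X0|X0] := leP X 0.
  by rewrite (le_trans X0)// addr_ge0 ?(ltW d0)// mulr_ge0 ?expR_ge0// (tv_le_ge0 Hd).
(* With e = y / (5 t) the loss factor is exactly exp y, and X exp(-y) >= X (1 - y) = X - d. *)
pose y := d / X; have y0 : 0 < y by rewrite divr_gt0.
have e0 : 0 < y / (5 * t) by rewrite divr_gt0// mulr_gt0.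
have := He _ e0 f f01; rewrite -/X.
have -> : - (r - 5 * (y / (5 * t))) * t = - r * t + y by field.
rewrite expRD -mulrA mulrCA => HX.
have H1 : X * expR (- y) <= expR (- r * t) * D.
  rewrite expRN ler_pdivrMr ?expR_gt0// mulrC.
  by rewrite mulrC in HX; rewrite mulrC.
have H2 : X * (1 - y) <= X * expR (- y) by rewrite ler_wpM2l ?(ltW X0)// expR_ge1Dx.
have H3 : X * y = d by rewrite /y mulrCA divff ?mulr1// gt_eqF.
lra.
Qed.
Hypothesis rate_gt0 : 0 < lam + pm - pM.
Let rate := lam + pm - pM.

Lemma expR_small e : 0 < e -> exists n : nat, expR (- rate * n%:R) <= e.
Proof.
move=> e0; pose n := Num.truncn (e^-1 / rate); exists n.+1.
rewrite mulNr expRN -[leRHS]invrK lef_pV2 ?posrE ?invr_gt0 ?expR_gt0//.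
rewrite (le_trans _ (expR_ge1Dx _))//.
have : e^-1 / rate < n.+1%:R by exact: truncnS_gt.
by rewrite ltr_pdivrMr// mulrC => H; rewrite (le_trans (ltW H))// lerDr.
Qed.

Lemma expR_rate_le1 t : 0 <= t -> expR (- rate * t) <= 1.
Proof. by move=> t0; rewrite -expR0 ler_expR mulNr oppr_le0 mulr_ge0// ltW. Qed.

Lemma is_qsdP nu : is_qsd P nu <-> is_prob nu /\ forall t, 0 <= t -> cond_law t nu = nu.
Proof.
split=> -[pnu H]; split=> // t t0.
  apply/funext => j; rewrite -[LHS]expect_point -[RHS]expect_point.
  rewrite expect_cond_law//; last exact: bounded_on_bool.
  by apply: H => //; exact: bounded_on_bool.
by move=> f bf; rewrite -expect_cond_law// H.
Qed.

Lemma qsd_exists : exists nu, is_qsd P nu.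
Proof.
pose m0 (i : E) : R := if i == x0 then 1 else 0.
have pm0 : is_prob m0.
  split=> [i|]; first by rewrite /m0; case: eqP.
  exact: esum_delta.
pose m (n : nat) := cond_law n%:R m0; pose c (n : nat) := expR (- rate * n%:R).
have pmn n : is_prob (m n) by exact: is_prob_cond_law.
have c0 n : 0 <= c n by exact: expR_ge0.
have contr t s : 0 <= t -> 0 <= s ->
    tv_le (cond_law t m0) (cond_law t (cond_law s m0)) (expR (- rate * t)).
  move=> t0 s0; rewrite -[expR _]mulr1; have ps := is_prob_cond_law s0 pm0.
  by apply: cond_law_contraction => //; exact: tv_le1.
(* Both laws are images under T_n, of [m0] and of the law at time l; these lie within distance 1. *)
have mono n l : tv_le (m n) (m (n + l)%N) (c n).
  rewrite /m natrD [n%:R + l%:R]addrC.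
  have -> : cond_law (l%:R + n%:R) m0 = cond_law n%:R (cond_law l%:R m0).
    exact: cond_lawD.
  exact: contr.
have wk mu nu D D' : D <= D' -> tv_le mu nu D -> tv_le mu nu D'.
  by move=> DD' Hd f f01; rewrite (le_trans (Hd f f01)).
have Hd n k : tv_le (m n) (m k) (c n + c k).
  have [nk|/ltnW kn] := leqP n k.
    by rewrite -(subnKC nk); apply: wk (mono _ _); rewrite lerDl.
  rewrite -(subnKC kn); apply: wk (tv_le_sym (pmn _) (pmn _) (mono _ _)).
  by rewrite lerDr.
have [nu pnu Hnu] := tv_complete pmn Hd expR_small.
exists nu; apply/is_qsdP; split=> // t t0.
have pt := is_prob_cond_law t0 pnu.
apply: tv_le0_eq => // e e0.
(* Each third of e covers one passage: from nu T_t to (m n) T_t, on to [m n], and back to nu. *)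
have [n cn] := expR_small (divr_gt0 e0 (ltr0Sn _ 2)).
have n0 : 0 <= n%:R :> R by [].
have H1 := tv_le_sym pnu (pmn n) (Hnu n).
have H2 : tv_le (cond_law t nu) (cond_law t (m n)) (c n).
  apply: wk (cond_law_contraction t0 pnu (pmn n) (Hnu n)).
  by rewrite ler_piMl// expR_rate_le1.
have H3 : tv_le (cond_law t (m n)) (m n) (c n).
  have ptm := is_prob_cond_law t0 (pmn n).
  (* T_t and T_n commute, so both laws are again images under T_n. *)
  apply: tv_le_sym => //; rewrite /m -(cond_lawD n0 t0 pm0) addrC (cond_lawD t0 n0 pm0).
  exact: contr.
apply: wk (tv_le_trans (tv_le_trans H2 H3) H1).
by move: cn; rewrite -/(c n); lra.
Qed.

(** Both laws are fixed by T_n, which brings any two laws within exp(- rate n). *)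
Lemma qsd_unique nu nu' : is_qsd P nu -> is_qsd P nu' -> nu = nu'.
Proof.
move=> /is_qsdP[pnu Hnu] /is_qsdP[pnu' Hnu']; apply: tv_le0_eq => // e e0.
have [n Hn] := expR_small e0; have n0 : 0 <= n%:R :> R by [].
move=> f f01; apply: le_trans Hn; rewrite -[leRHS]mulr1.
have := cond_law_contraction n0 pnu pnu' (tv_le1 pnu pnu').
by rewrite Hnu// Hnu'//; apply.
Qed.
Lemma dTV_condT t mu nu : 0 <= t -> is_prob mu -> is_prob nu ->
  (dTV (condT P mu t) (condT P nu t) <=
   (expR (- rate * t))%:E * dTV (expect mu) (expect nu))%E.
Proof.
move=> t0 pmu pnu; have [D -> Hd] := tv_le_dTV pmu pnu; rewrite -EFinM.
rewrite -(@eq_dTV _ _ (expect (cond_law t mu)) (expect (cond_law t nu))).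
- by apply: dTV_le; [exact: is_prob_cond_law..|exact: cond_law_contraction].
- by move=> f bf; rewrite expect_cond_law.
- by move=> f bf; rewrite expect_cond_law.
Qed.

Lemma dTV_condT_qsd t mu nu : 0 <= t -> is_prob mu -> is_qsd P nu ->
  (dTV (condT P mu t) (expect nu) <= (expR (- rate * t))%:E)%E.
Proof.
move=> t0 pmu [pnu qnu].
rewrite (@eq_dTV _ _ _ _ (condT P mu t) (condT P nu t))//; last first.
  by move=> f bf; rewrite qnu.
rewrite (le_trans (dTV_condT t0 pmu pnu))// -[leRHS]mule1.
by rewrite lee_wpmul2l ?lee_fin ?expR_ge0// dTV_le//; exact: tv_le1.
Qed.

End BoundedRates.

(** * Off-diagonal rates and lambda as a splitting bound *)

Section RateData.
Context {R : realType} {E : countType}.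
Variable Q : E -> E -> R.
Hypothesis hQ : is_rate_matrix Q.

Lemma off_ge0 i j : 0 <= off Q i j.
Proof.
by rewrite /off; have [//|ji] := eqVneq j i; apply: hQ.1; rewrite eq_sym.
Qed.

Lemma esum_off i : (\esum_(j in [set: E]) (off Q i j)%:E = exit_rate Q i)%E.
Proof.
rewrite /exit_rate [RHS]esum_mkcond; apply: eq_esum => j _; rewrite /off.
have [->|ji] := eqVneq j i; first by rewrite memNset//= eqxx.
by rewrite mem_set.
Qed.

Lemma asummable_off i : asummable (off Q i).
Proof.
rewrite /asummable; under eq_esum do rewrite ger0_norm ?off_ge0//.
by rewrite esum_off hQ.2 ltry.
Qed.

Lemma EFin_dsum_off i : (dsum (off Q i))%:E = exit_rate Q i.
Proof.
by rewrite dsum_nneg ?esum_off ?hQ.2// => j; exact: off_ge0.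
Qed.

(** The three terms of lambda are spread over all states: Q x y sits at y, Q y x at x, and the
    minimum at every other state. There a state j contributes Q x j or Q y j according to whether it
    lies in A, and either is at least the minimum. *)
Lemma lambda_le_split x y (A : pred E) : x != y -> ~~ A x -> A y ->
  (lambda Q <= (dsum (fun j => off Q x j * (A j)%:R)
                + dsum (fun j => off Q y j * (~~ A j)%:R))%:E)%E.
Proof.
move=> xy Ax Ay.
have sA z (B : pred E) : asummable (fun j => off Q z j * (B j)%:R).
  apply: asummable_wdsum; [exact: asummable_off|exact: off_ge0|].
  exact: bounded_on_bool.
have oA0 z (B : pred E) j : 0 <= off Q z j * (B j)%:R.
  by rewrite mulr_ge0 ?off_ge0.
pose mn j := if (j == x) || (j == y) then 0 else Num.min (Q x j) (Q y j).
have mn0 j : 0 <= mn j.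
  rewrite /mn; case: ifPn => //; rewrite negb_or => /andP[jx jy].
  by rewrite le_min !hQ.1// eq_sym.
pose qxy j := if j == y then Q x y else 0; pose qyx j := if j == x then Q y x else 0.
have qxy0 j : 0 <= qxy j by rewrite /qxy; case: eqP => // _; exact: hQ.1.
have qyx0 j : 0 <= qyx j by rewrite /qyx; case: eqP => // _; apply: hQ.1; rewrite eq_sym.
apply: (@le_trans _ _ ((Q x y)%:E + (Q y x)%:E +
    \esum_(j in [set j | j != x /\ j != y]) (Num.min (Q x j) (Q y j))%:E)%E).
  by apply: ereal_inf_lbound; exists x, y.
have dE z (B : pred E) : (dsum (fun j => off Q z j * (B j)%:R))%:E =
    (\esum_(j in [set: E]) (off Q z j * (B j)%:R)%:E)%E.
  by rewrite dsum_nneg// fineK// asummable_nneg.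
rewrite EFinD dE (dE y (predC A)) -esumD; try by move=> j _; rewrite lee_fin.
have -> : (\esum_(j in [set j | j != x /\ j != y]) (Num.min (Q x j) (Q y j))%:E =
           \esum_(j in [set: E]) (mn j)%:E)%E.
  rewrite esum_mkcond; apply: eq_esum => j _; rewrite /mn.
  case: ifPn => [/set_mem[/negbTE -> /negbTE ->]//|/negP nj].
  case: ifPn => //; rewrite negb_or => /andP[jx jy].
  by case: nj; exact/mem_set.
have yx : y != x by rewrite eq_sym.
rewrite -(esum_delta y (hQ.1 _ _ xy)) -(esum_delta x (hQ.1 _ _ yx)).
rewrite -!esumD; try by move=> j _; rewrite -?EFinD lee_fin; first
  [exact: mn0|exact: qxy0|exact: qyx0|exact: addr_ge0 (qxy0 j) (qyx0 j)].
apply: le_esum => j _; rewrite -!EFinD lee_fin /mn.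
have [jx|jx] := eqVneq j x.
  rewrite jx (negbTE xy) /= add0r addr0 Ax mulr1n mulr1 /off (negbTE xy).
  by rewrite eqxx mul0r add0r.
have [->|jy] := eqVneq j y.
  by rewrite /= !addr0 Ay mulr1n mulr1 /off eqxx eq_sym (negbTE xy) mul0r addr0.
rewrite /= !add0r /off (negbTE jx) (negbTE jy).
by case: (A j); rewrite mulr1n mulr0n mulr1 mulr0 ?addr0 ?add0r ge_min lexx ?orbT.
Qed.

End RateData.

Theorem corollary1p4 (R : realType) (E : countType)
    (Q : E -> E -> R) (p0 : E -> R) (P : R -> option E -> option E -> R)
    (hQ : is_rate_matrix Q)
    (hirr : irreducible_rates Q)
    (hpos : positive_recurrent Q)
    (hp0 : forall i, 0 <= p0 i)
    (hp0_neq0 : exists i, p0 i != 0)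
    (hP : is_semigroup Q p0 P)
    (rho : \bar R)
    (hrho : rho = (lambda Q - (ereal_sup (range (fun i => (p0 i)%:E))
                               - ereal_inf (range (fun i => (p0 i)%:E))))%E)
    (hrho_gt0 : (0 < rho)%E)
    (hQ_bnd : (ereal_sup (range (exit_rate Q)) < +oo)%E)
    (hp0_bnd : (ereal_sup (range (fun i => (p0 i)%:E)) < +oo)%E) :
  (forall mu nu : E -> R, is_prob mu -> is_prob nu ->
     forall t : R, 0 <= t ->
       (dTV (condT P mu t) (condT P nu t)
        <= expeR (- (rho * t%:E)) * dTV (expect mu) (expect nu))%E) /\
  (exists! nu_qs : E -> R, is_qsd P nu_qs) /\
  (forall nu_qs mu : E -> R, is_qsd P nu_qs -> is_prob mu ->
     forall t : R, 0 <= t ->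
       (dTV (condT P mu t) (expect nu_qs) <= expeR (- (rho * t%:E)))%E).
Proof.
have [x0 _] := hp0_neq0.
pose supQ := ereal_sup (range (exit_rate Q)).
pose sup0 := ereal_sup (range (fun i => (p0 i)%:E)).
pose inf0 := ereal_inf (range (fun i => (p0 i)%:E)).
have le_supQ i : (exit_rate Q i <= supQ)%E by apply: ereal_sup_ubound; exists i.
have le_sup0 i : ((p0 i)%:E <= sup0)%E by apply: ereal_sup_ubound; exists i.
have inf0_le i : (inf0 <= (p0 i)%:E)%E by apply: ereal_inf_lbound; exists i.
have inf0_ge0 : (0 <= inf0)%E by apply: le_ereal_inf_tmp => _ [i _ <-]; rewrite lee_fin.
have supQ_fin : supQ \is a fin_num.
  rewrite ge0_fin_numE// (le_trans _ (le_supQ x0))//.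
  by rewrite -EFin_dsum_off// lee_fin dsum_ge0// => j; exact: off_ge0.
have sup0_fin : sup0 \is a fin_num.
  by rewrite ge0_fin_numE// (le_trans _ (le_sup0 x0))// lee_fin.
have inf0_fin : inf0 \is a fin_num.
  by rewrite ge0_fin_numE// (le_lt_trans (inf0_le x0))// ltry.
have hoff i : dsum (off Q i) <= fine supQ.
  by rewrite -lee_fin EFin_dsum_off// fineK.
have hpM i : p0 i <= fine sup0 by rewrite -lee_fin fineK.
have hpm i : fine inf0 <= p0 i by rewrite -lee_fin fineK.
have off0 := off_ge0 hQ; have offS := asummable_off hQ.
(* The contraction argument takes a real [lam], whereas lambda can be +oo. In the first alternative
   there is only one state, hence one probability measure; in the second, rho is the real rate. *)
suff [lam [lam_le rate_gt0 rhoE]] : exists lam,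
    [/\ (forall x y, x != y -> forall A : pred E, ~~ A x -> A y ->
       lam <= dsum (fun j => off Q x j * (A j)%:R) + dsum (fun j => off Q y j * (~~ A j)%:R)),
     0 < lam + fine inf0 - fine sup0 &
     (forall x : E, x = x0) \/ rho = (lam + fine inf0 - fine sup0)%:E].
  have cv := dTV_condT hP off0 offS hoff hp0 hpM x0 hpm lam_le.
  have cq := dTV_condT_qsd hP off0 offS hoff hp0 hpM x0 hpm lam_le.
  have rE (t : R) : rho = (lam + fine inf0 - fine sup0)%:E ->
      expeR (- (rho * t%:E))%E = (expR (- (lam + fine inf0 - fine sup0) * t))%:E.
    by move=> ->; rewrite mulNr.
  have triv (mu nu : E -> R) : (forall x : E, x = x0) -> is_prob mu -> is_prob nu ->
      mu = nu.
    move=> Ex pmu pnu; apply: tv_le0_eq => // e e0 f f01.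
    have fE : f =1 (fun=> f x0) by move=> x; rewrite (Ex x).
    by rewrite !(eq_expect _ fE) !expect_cst// subrr ltW.
  have self (u : (E -> R) -> R) : (dTV u u <= 0)%E.
    rewrite /dTV (_ : [set _ | _ in _] = [set 0%E]) ?ereal_sup1 ?mule0//.
    apply/seteqP; split=> [_ [f _ <-]|_ ->]/=; first by rewrite subrr.
    by exists (fun=> 0); rewrite ?subrr// => i; rewrite normr0.
  split; [|split].
  - move=> mu nu pmu pnu t t0; case: rhoE => [Ex|/rE ->]; last exact: cv.
    rewrite (triv _ _ Ex pmu pnu) (le_trans (self _))// mule_ge0 ?expeR_ge0//.
    exact: dTV_ge0.
  - have [nu qnu] := qsd_exists hP off0 offS hoff hp0 hpM x0 hpm lam_le rate_gt0.
    exists nu; split=> // nu' qnu'.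
    exact: (qsd_unique hP off0 offS hoff hp0 hpM x0 hpm lam_le rate_gt0).
  - move=> nu mu qnu pmu t t0; case: rhoE => [Ex|/rE ->]; last exact: cq.
    rewrite (triv _ _ Ex pmu qnu.1) (@eq_dTV _ _ _ _ (expect nu) (expect nu))//.
      by rewrite (le_trans (self _))// expeR_ge0.
    by move=> f; exact: qnu.2.
(* On a singleton [rho] is infinite and all laws agree: any [lam] with a positive
   rate will do. *)
have [Ex|] := pselect (forall x : E, x = x0).
  exists (1 + fine sup0 - fine inf0); split; last by left.
    by move=> x y; rewrite (Ex x) (Ex y) eqxx.
  by rewrite subrK addrK ltr01.
move=> /existsNP[x1 /eqP x10].
(* A second state gives a splitting, which bounds lambda by a finite rate; rho > 0 excludes -oo. *)
have lam_fin : lambda Q \is a fin_num.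
  have : (lambda Q < +oo)%E.
    apply: le_lt_trans (lambda_le_split hQ (A := pred1 x0) x10 _ _) _; rewrite ?ltry//=.
  move: hrho_gt0; rewrite hrho -/sup0 -/inf0 -(fineK sup0_fin) -(fineK inf0_fin).
  by case: (lambda Q).
exists (fine (lambda Q)); split.
- by move=> x y xy A Ax Ay; rewrite -lee_fin fineK// lambda_le_split.
- rewrite -lte_fin; move: hrho_gt0; rewrite hrho -/sup0 -/inf0.
  rewrite -(fineK sup0_fin) -(fineK inf0_fin) -(fineK lam_fin) -!EFinB !lte_fin/=.
  lra.
- right; rewrite hrho -/sup0 -/inf0.
  rewrite -(fineK sup0_fin) -(fineK inf0_fin) -(fineK lam_fin) -!EFinB /=.
  by congr EFin; ring.
Qed.
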